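(* The following functionals are not computable in any $\mathsf{S}^2_k$: (a) any functional $\Phi:(\mathbb{R}\to\mathbb{R})\to\mathbb{R}$ such that for all cliquish $f:[0,1]\to[0,1]$, we have $\Phi(f)\in C_f$; (b) any functional $\Psi:(\mathbb{R}\to\mathbb{R})\to(\mathbb{R}^2\to\mathbb{R})$ such that for all cliquish $f:[0,1]\to[0,1]$, $\Psi(f,p,q)=\sup_{x\in[p,q]}f(x)$ for $p,q\in[0,1]$; (c) any functional $\zeta:(\mathbb{R}\to\mathbb{R})\to((\mathbb{N}\times\mathbb{N})\to\mathbb{Q}^2)$ such that for all cliquish $f:[0,1]\to[0,1]$ and any $n,m\in\mathbb{N}$, $\zeta(f,m,n)$ is (the pair of end-points of) an open interval such that $C_f=\bigcap_{n\in\mathbb{N}}\big(\bigcup_{m\in\mathbb{N}}\zeta(f,m,n)\big)$; (d) any functional $\Xi:(\mathbb{R}\to\mathbb{R})\to(\mathbb{R}\to\mathbb{R})^2$ such that for all cliquish $f:[0,1]\to[0,1]$, $\Xi(f)=(g,h)$ with $f=g+h$ on $[0,1]$ and $g,h$ quasi-continuous on $[0,1]$; (e) any functional $\Gamma:(\mathbb{R}\to\mathbb{R})\to((\mathbb{R}\times\mathbb{N})\to\mathbb{N})$ such that for all cliquish $f:[0,1]\to[0,1]$, $\Gamma(f)$ is a modulus of continuity for $f$; (f) any functional $\epsilon:(\mathbb{R}\to\mathbb{R})\to((\mathbb{R}\times\mathbb{N}^2)\to\mathbb{Q}^2)$ such that for all cliquish $f:[0,1]\to[0,1]$, $\epsilon(f)$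 is a modulus of cliquishness for $f$; (g) any functional $\varepsilon:(\mathbb{R}\to\mathbb{R})\to\mathbb{R}$ such that for all cliquish Riemann integrable $f:[0,1]\to[0,1]$ with $\int_0^1f(x)\,dx=0$, we have $\varepsilon(f)\in[0,1]$ and $f(\varepsilon(f))=0$; (h) any functional $\phi:(\mathbb{R}\to\mathbb{R})\to\mathbb{R}$ such that for cliquish Riemann integrable $f:[0,1]\to[0,1]$ with $F(x):=\int_0^xf(t)\,dt$, we have $\phi(f)\in[0,1]$ and $F'(\phi(f))=f(\phi(f))$. In particular, each of these functionals computes, together with $\exists^2$, a Cantor realiser. These results remain valid if the functionals are additionally given the oscillation function $\mathrm{osc}_f$ as an input.
   Context: Computability is Kleene's S1-S9 computability for total objects of finite type over $\mathbb{N}$ (metatheory ZFC). The partial relation $\{e\}(\vec\Phi)\simeq y$ ($y\in\mathbb{N}$, $\vec\Phi$ a list of finite-type objects) is inductively generated by: S1 successor $x+1$; S2 constants; S3 projection to a number argument; S4 composition $\{e_1\}(\{e_2\}(\vec\Phi),\vec\Phi)$; S5 primitive recursion; S6 permutation of arguments; S7 $\{e\}(f,x,\vec\Phi)=f(x)$ for $f\in\mathbb{N}^{\mathbb{N}}$; S8 $\{e\}(\Psi^{n+2},\vec\Phi)=\Psi(\lambda\xi^{n}.\{e_1\}(\xi,\Psi,\vec\Phi))$ when the inner function is total; S9 $\{e\}(d,\vec\Phi,\vec\Phi')=\{d\}(\vec\Phi)$. A functional is computable in $G$ if, after currying so that values are natural numbers, it equals $\lambda\vec\Phi.\{e\}(G,\vec\Phi)$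 for some index $e$. Real numbers are represented by fast-converging Cauchy sequences of rationals (elements of $\mathbb{N}^{\mathbb{N}}$); functions $\mathbb{R}\to\mathbb{R}$ are maps on representations respecting equality of reals, and functions on $[0,1]$ are treated likewise (as inputs of type $\mathbb{R}\to\mathbb{R}$). Subsets of $\mathbb{R}$ are given by characteristic functions, with no further data. $[p,q]$ presupposes $p\le q$. $\exists^2:\mathbb{N}^{\mathbb{N}}\to\{0,1\}$ satisfies $\exists^2(f)=0\leftrightarrow(\exists n)(f(n)=0)$. For $k\ge1$, $\mathsf{S}^2_k:\mathbb{N}^{\mathbb{N}}\to\{0,1\}$ decides the truth of $\Sigma^1_k$-formulas (in normal form, with the input $f\in\mathbb{N}^{\mathbb{N}}$ as parameter); e.g. $\mathsf{S}^2=\mathsf{S}^2_1$ satisfies $\mathsf{S}^2(f)=0\leftrightarrow(\exists g\in\mathbb{N}^{\mathbb{N}})(\forall n)(f(\overline{g}n)=0)$, with $\overline{g}n$ the code of $(g(0),\dots,g(n-1))$. ''Not computable in any $\mathsf{S}^2_k$'' means that for no $k$ is a functional with the stated property computable in $\mathsf{S}^2_k$. For functions on $[0,1]$, neighbourhoods are relative to $[0,1]$; $B(x,r)$ is the open ball with centre $x$ and radius $r$; $C_f$ is the set of points of continuity of $f$. $f:[0,1]\to\mathbb{R}$ is quasi-continuous (resp. cliquish) if for every $x_0\in[0,1]$, $\epsilon>0$ and open neighbourhood $U$ of $x_0$ there is a non-empty open $G\subset U$ with $(\forall x\in G)(|f(x_0)-f(x)|<\epsilon)$ (resp. $(\forall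 y,z\in G)(|f(y)-f(z)|<\epsilon)$). A modulus of continuity for $f$ (with $C_f\ne\emptyset$) is $F:(\mathbb{R}\times\mathbb{N})\to\mathbb{N}$ such that for all $k\in\mathbb{N}$, $x\in C_f$, $y\in[0,1]$: $|x-y|<\frac1{2^{F(x,k)}}\to|f(x)-f(y)|<\frac1{2^k}$. A modulus of cliquishness for $f$ is $F:(\mathbb{R}\times\mathbb{N}^2)\to\mathbb{Q}^2$ such that for all $x\in[0,1]$, $k,N\in\mathbb{N}$, writing $F(x,k,N)=(c,d)$, the interval $(c,d)$ is non-empty, $(c,d)\subset B(x,\frac1{2^N})\cap[0,1]$, and $(\forall y,z\in(c,d))(|f(y)-f(z)|<\frac1{2^k})$. Oscillation: $\mathrm{osc}_f([a,b]):=\sup_{x\in[a,b]}f(x)-\inf_{x\in[a,b]}f(x)$ (similarly on balls) and $\mathrm{osc}_f(x):=\lim_{k\to\infty}\mathrm{osc}_f(B(x,\frac1{2^k}))$. A Cantor realiser is any $\Phi:\big((\mathbb{R}\to\{0,1\})\times(\mathbb{R}\to\mathbb{N})\big)\to\mathbb{R}$ such that $\Phi(A,Y)\in[0,1]\setminus A$ whenever $A\subset[0,1]$ is non-empty and $Y:[0,1]\to\mathbb{N}$ is injective on $A$. *)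

(* Defs.v *)
From Stdlib Require Import Reals List Arith Cantor Permutation ClassicalEpsilon.
From Coquelicot Require Import Coquelicot.
Import ListNotations.
Open Scope R_scope.

(** * Finite types over N and their total objects *)

Inductive ty : Type :=
| Nat : ty
| Arr : ty -> ty -> ty.

Fixpoint interp (s : ty) : Type :=
  match s with
  | Nat => nat
  | Arr s t => interp s -> interp t
  end.

Record obj : Type := Obj { otype : ty; oval : interp otype }.

(* Every finite type is s_1 -> ... -> s_k -> Nat; [args] is [s_1; ...; s_k]. *)
Fixpoint args (s : ty) : list ty :=
  match s with
  | Nat => []
  | Arr s t => s :: args t
  end.

Fixpoint env (l : list ty) : Type :=
  match l with
  | [] => unit
  | s :: l => (interp s * env l)%type
  end.

Fixpoint objs {l : list ty} : env l -> list obj :=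
  match l with
  | [] => fun _ => []
  | s :: l => fun xs => Obj s (fst xs) :: objs (snd xs)
  end.

Fixpoint apply (s : ty) : interp s -> env (args s) -> nat :=
  match s with
  | Nat => fun x _ => x
  | Arr s t => fun F xs => apply t (F (fst xs)) (snd xs)
  end.

(** * Kleene's S1-S9 *)

(* A bijection between finite sequences of numbers and numbers. *)
Fixpoint code (l : list nat) : nat :=
  match l with
  | [] => 0%nat
  | a :: l => S (Cantor.to_nat (a, code l))
  end.

Arguments code : simpl never.

(* [Kleene e Phi y] is {e}(Phi) ~ y.  Clause S8 is stated for an argument Psi
   of any finite type s_1 -> ... -> s_k -> Nat:
     {e}(Psi, Phi) = Psi (fun xi_1 => {e_1}(xi_1, Psi, Phi), ...,
                          fun xi_k => {e_k}(xi_k, Psi, Phi)),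
   where xi_j is the list of arguments of the type s_j and the k inner
   functions are required to be total.  For Psi of pure type n+2 this is k = 1
   with a single xi of pure type n. *)
Inductive Kleene : nat -> list obj -> nat -> Prop :=
| S1 x Phi :
    Kleene (code [1%nat]) (Obj Nat x :: Phi) (S x)
| S2 q Phi :
    Kleene (code [2%nat; q]) Phi q
| S3 x Phi :
    Kleene (code [3%nat]) (Obj Nat x :: Phi) x
| S4 e1 e2 Phi y z :
    Kleene e2 Phi y ->
    Kleene e1 (Obj Nat y :: Phi) z ->
    Kleene (code [4%nat; e1; e2]) Phi z
| S5_0 e1 e2 Phi y :
    Kleene e1 Phi y ->
    Kleene (code [5%nat; e1; e2]) (Obj Nat 0%nat :: Phi) y
| S5_S e1 e2 x Phi y z :
    Kleene (code [5%nat; e1; e2]) (Obj Nat x :: Phi) y ->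
    Kleene e2 (Obj Nat x :: Obj Nat y :: Phi) z ->
    Kleene (code [5%nat; e1; e2]) (Obj Nat (S x) :: Phi) z
| S6 e1 (p : list nat) Phi y :
    Permutation p (seq 0 (length Phi)) ->
    Kleene e1 (map (fun i => nth i Phi (Obj Nat 0%nat)) p) y ->
    Kleene (code (6%nat :: e1 :: p)) Phi y
| S7 (f : interp (Arr Nat Nat)) (x : nat) Phi :
    Kleene (code [7%nat]) (Obj (Arr Nat Nat) f :: Obj Nat x :: Phi) (f x)
| S8 (s : ty) (Psi : interp s) (es : list nat) (G : env (args s)) Phi :
    length es = length (args s) ->
    (forall j e t (g : interp t),
        nth_error es j = Some e ->
        nth_error (objs G) j = Some (Obj t g) ->
        forall xi : env (args t),
          Kleene e (objs xi ++ Obj s Psi :: Phi) (apply t g xi)) ->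
    Kleene (code (8%nat :: es)) (Obj s Psi :: Phi) (apply s Psi G)
| S9 d Phi Phi' y :
    Kleene d Phi y ->
    Kleene (code [9%nat; length Phi]) (Obj Nat d :: Phi ++ Phi') y.

Definition computable_in (G : list obj) (s : ty) (T : interp s) : Prop :=
  exists e : nat, forall xi : env (args s), Kleene e (G ++ objs xi) (apply s T xi).

(** * The functionals E^2 and S^2_k *)

Definition ty2 : ty := Arr (Arr Nat Nat) Nat.

Definition E2 : interp ty2 :=
  fun f => if excluded_middle_informative (exists n, f n = 0%nat) then 0%nat else 1%nat.

Definition initseg (g : nat -> nat) (n : nat) : nat := code (map g (seq 0 n)).

(* The one-element tuple is its element, so that k = 1 gives f (initseg g n). *)
Fixpoint tuple (l : list nat) : nat :=
  match l with
  | [] => 0%nat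
  | [a] => a
  | a :: l => Cantor.to_nat (a, tuple l)
  end.

(* k alternating function quantifiers, the first one existential iff [b]. *)
Fixpoint alternate (b : bool) (k : nat) (M : list (nat -> nat) -> Prop) : Prop :=
  match k with
  | O => M []
  | S k =>
      if b then exists g, alternate false k (fun gs => M (g :: gs))
      else forall g, alternate true k (fun gs => M (g :: gs))
  end.

(* The Sigma^1_k normal form: the number quantifier is dual to the innermost
   function quantifier, which is existential iff k is odd. *)
Definition Sigma1 (k : nat) (f : nat -> nat) : Prop :=
  alternate true k (fun gs =>
    if Nat.odd k
    then forall n, f (tuple (map (fun g => initseg g n) gs)) = 0%nat
    else exists n, f (tuple (map (fun g => initseg g n) gs)) = 0%nat).

Definition S2k (k : nat) : interp ty2 :=
  fun f => if excluded_middle_informative (Sigma1 k f) then 0%nat else 1%nat.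

(** * Representations by objects of finite type *)

Record rspace : Type := RSpace {
  carrier :> Type;
  rty : ty;
  rep : interp rty -> carrier -> Prop }.

Arguments rep _ _ _ : clear implicits.

Definition NatS : rspace := RSpace nat Nat (fun n m => n = m).

Definition BoolS : rspace := RSpace bool Nat (fun n b => n = Nat.b2n b).

(* Every number codes a rational, and every rational has a code. *)
Definition rat (c : nat) : R :=
  let (a, b) := Cantor.of_nat c in
  let (p, q) := Cantor.of_nat a in
  (INR p - INR q) / INR (S b).

Definition Rat2S : rspace :=
  RSpace (R * R) Nat
    (fun c v => v = (rat (fst (Cantor.of_nat c)), rat (snd (Cantor.of_nat c)))).

Definition RealS : rspace :=
  RSpace R (Arr Nat Nat)
    (fun x r =>
       (forall n i : nat, Rabs (rat (x n) - rat (x (n + i)%nat)) < / 2 ^ n) /\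
       is_lim_seq (fun n => rat (x n)) r).

(* A map on representations has some [f] with [rep (FunS X Y) F f] exactly when
   it respects the equality of the represented elements. *)
Definition FunS (X Y : rspace) : rspace :=
  RSpace (X -> Y) (Arr (rty X) (rty Y))
    (fun F f => forall x a, rep X x a -> rep Y (F x) (f a)).

(* Pairs, as functions on {0,1}. *)
Definition PairS (X : rspace) : rspace :=
  RSpace (X * X) (Arr Nat (rty X))
    (fun P v => rep X (P 0%nat) (fst v) /\ rep X (P 1%nat) (snd v)).

Definition RR : rspace := FunS RealS RealS.

(** * Real analysis on [0,1] *)

Definition I01 (x : R) : Prop := 0 <= x <= 1.

Definition open_in_I (G : R -> Prop) : Prop :=
  exists V : R -> Prop, open V /\ forall x, G x <-> I01 x /\ V x.

Definition quasi_continuous (f : R -> R) : Prop :=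
  forall x0 eps (U : R -> Prop),
    I01 x0 -> 0 < eps -> open_in_I U -> U x0 ->
    exists G : R -> Prop,
      open_in_I G /\ (exists x, G x) /\ (forall x, G x -> U x) /\
      (forall x, G x -> Rabs (f x0 - f x) < eps).

Definition cliquish (f : R -> R) : Prop :=
  forall x0 eps (U : R -> Prop),
    I01 x0 -> 0 < eps -> open_in_I U -> U x0 ->
    exists G : R -> Prop,
      open_in_I G /\ (exists x, G x) /\ (forall x, G x -> U x) /\
      (forall y z, G y -> G z -> Rabs (f y - f z) < eps).

Definition cliquish01 (f : R -> R) : Prop :=
  (forall x, I01 x -> I01 (f x)) /\ cliquish f.

Definition cont_pts (f : R -> R) (x : R) : Prop := I01 x /\ continue_in f I01 x.

Definition image (f : R -> R) (D : R -> Prop) (v : R) : Prop :=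
  exists x, D x /\ v = f x.

Definition osc_on (f : R -> R) (D : R -> Prop) : R :=
  real (Lub_Rbar (image f D)) - real (Glb_Rbar (image f D)).

Definition osc (f : R -> R) (x : R) : R :=
  real (Lim_seq (fun k => osc_on f (fun y => I01 y /\ Rabs (y - x) < / 2 ^ k))).

Definition modulus_of_continuity (f : R -> R) (M : R -> nat -> nat) : Prop :=
  forall k x y, cont_pts f x -> I01 y ->
    Rabs (x - y) < / 2 ^ M x k -> Rabs (f x - f y) < / 2 ^ k.

Definition modulus_of_cliquishness (f : R -> R) (M : R -> nat -> nat -> R * R) : Prop :=
  forall x k N, I01 x ->
    let (c, d) := M x k N in
    c < d /\
    (forall y, c < y < d -> Rabs (y - x) < / 2 ^ N /\ I01 y) /\
    (forall y z, c < y < d -> c < z < d -> Rabs (f y - f z) < / 2 ^ k).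

(** * Cantor realisers *)

Definition cantor_ty : ty :=
  Arr (rty (FunS RealS BoolS)) (Arr (rty (FunS RealS NatS)) (rty RealS)).

Definition cantor_realiser (Phi : interp cantor_ty) : Prop :=
  forall A Y (a : R -> bool) (y : R -> nat),
    rep (FunS RealS BoolS) A a -> rep (FunS RealS NatS) Y y ->
    exists r : R,
      rep RealS (Phi A Y) r /\
      ((exists x, a x = true) ->
       (forall x, a x = true -> I01 x) ->
       (forall x x', a x = true -> a x' = true -> y x = y x' -> x = x') ->
       I01 r /\ a r = false).

(** * Functionals with a real function as input *)

(* Phi : (R -> R) -> X such that post f (Phi f) whenever pre f. *)
Definition solves (X : rspace) (pre : (R -> R) -> Prop) (post : (R -> R) -> X -> Prop)
    (Phi : interp (Arr (rty RR) (rty X))) : Prop :=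
  forall F (f : R -> R), rep RR F f ->
    exists v : X, rep X (Phi F) v /\ (pre f -> post f v).

(* The same with the oscillation function, a function on [0,1] given as an
   input of type R -> R, as an additional argument. *)
Definition solves_osc (X : rspace) (pre : (R -> R) -> Prop) (post : (R -> R) -> X -> Prop)
    (Phi : interp (Arr (rty RR) (Arr (rty RR) (rty X)))) : Prop :=
  forall F O (f o : R -> R), rep RR F f -> rep RR O o ->
    exists v : X, rep X (Phi F O) v /\
      (pre f -> (forall x, I01 x -> o x = osc f x) -> post f v).

Definition not_computable_in_any_S2 (s : ty) (P : interp s -> Prop) : Prop :=
  forall k : nat, (1 <= k)%nat ->
    ~ exists Phi : interp s, P Phi /\ computable_in [Obj ty2 (S2k k)] s Phi.

Definition computes_cantor_with_E2 (s : ty) (P : interp s -> Prop) : Prop :=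
  forall Phi : interp s, P Phi ->
    exists C : interp cantor_ty,
      cantor_realiser C /\ computable_in [Obj s Phi; Obj ty2 E2] cantor_ty C.

Definition hard (X : rspace) (pre : (R -> R) -> Prop) (post : (R -> R) -> X -> Prop) : Prop :=
  not_computable_in_any_S2 _ (solves X pre post) /\
  computes_cantor_with_E2 _ (solves X pre post) /\
  not_computable_in_any_S2 _ (solves_osc X pre post) /\
  computes_cantor_with_E2 _ (solves_osc X pre post).

(* Main.v *)
From Stdlib Require Import Reals List Arith Lia ZArith Permutation Lra Classical
  ClassicalEpsilon FunctionalExtensionality.
From Coquelicot Require Import Coquelicot.
From mathcomp Require classical_sets.
Require Import Defs.
Import ListNotations.
Open Scope R_scope.

(** Everything goes through Cantor realisers: each of the functionals computes one together with
E2, and no Cantor realiser is computable in a functional of type two.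

A set A with an injection Y from A to the natural numbers gives the function [spike], with value
2^-(Y(x)+1) at the points x of A and 0 elsewhere. Only finitely many of its values exceed a given
size, so near any point the values at the other points are small ([spike_small]). Hence this
function is cliquish, its integral over every interval is 0, it is continuous exactly at its
zeros, and it is equal to its own oscillation function. The last fact disposes of the versions
with the oscillation as an additional input: the solution functional is simply given the same
function twice.

A continuity point of [spike], a zero of [spike], or a point where its integral has the right
derivative, is a point outside A ([yields_realiser_direct]). In the other problems the solution is
a function or a pair of functions, and a point outside A is the limit of nested rational
intervals, the n-th of which passes a test that E2 can decide from the solution and that forces
[spike] to be at most 2 * 2^-n on the interval (or, for the set of continuity points, forces the
interval into the n-th open set). For this the solution is evaluated at rational points only, so
the rationals are first removed from A and the n-th interval is made to avoid the n-th rational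
([yields_realiser_by_tests]): then rationals are continuity points of [spike], where a modulus of
continuity means something, while the limit is irrational. Quasi-continuous functions may be
tested in this way because their values on an interval are limits of their values at rationals.

All these programs have to be presented by indices of S1-S9. They are written as ordinary
functions, and a small calculus of families of numbers [Computable] from an object and E2 turns
them into indices. Its main steps are the application of a given functional to computable
arguments (S6 and S8, [applicable_var]), and unbounded search (self-application by S9,
[kleene_search]), which together with the quantifiers decided by E2 makes every function with an
arithmetical graph available ([computable_graph]).

For the second claim, let Phi be computable in a functional Z of type two, for instance S^2_k, and
let the Cantor realiser C be computable in Phi and E2 ([cantor_realiser_not_computable]).
Composing the two indices by S1-S9 is a substitution of a functional of type three; instead the
computations are carried out symbolically ([run]), with arguments that are closures: an index
together with a list of closures, evaluated only when applied. A computation with Z, E2, A, Y and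
Phi is thereby an evaluation of finite expressions in which Z, E2, A and Y are only consulted at
functions that are themselves computed by closures, and [adequacy] transports every S1-S9
computation to it.

The evaluation is monotone in the consulted oracles, which may therefore be partial. By Zorn's
lemma there is a maximal partial injection from the reals to the natural numbers that maps each
real in its domain to the code of a closure that computes it, relative to that same partial
injection ([self_indexed_maximal]). By maximality every real computed by a closure is in the
domain. Let A be the domain inside [0,1], and Y the injection. As far as closures can tell, A
contains every real of [0,1]. But C(A,Y) is computed by a closure, so it lies in A, although a
Cantor realiser must avoid A. *)

(** * Rearranging the arguments of a computation *)

Notation nth_obj := (fun Phi i => nth i Phi (Obj Nat 0%nat)).

Lemma objs_length l (xi : env l) : length (objs xi) = length l.
Proof. induction l; cbn; [reflexivity|now rewrite IHl]. Qed.

(** The uses of S6 below are instances of this: a duplicate-free selection of the arguments is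
completed to a permutation that moves the other arguments to the end, where S9 discards them. *)
Lemma kleene_select N q e :
  NoDup q -> (forall j, In j q -> (j < N)%nat) ->
  exists e', forall Phi y, length Phi = N ->
    Kleene e (map (nth_obj Phi) q) y -> Kleene e' Phi y.
Proof.
  intros Hq HN.
  set (rest := filter (fun j => if in_dec Nat.eq_dec j q then false else true) (seq 0 N)).
  exists (code (6%nat :: code [4%nat; code [9%nat; length q]; code [2%nat; e]] :: q ++ rest)).
  intros Phi y HPhi H; apply S6.
  - rewrite HPhi; apply NoDup_Permutation.
    + apply NoDup_app; [exact Hq|apply NoDup_filter, seq_NoDup|].
      intros j Hj Hj'; apply filter_In in Hj' as [_ Hj'].
      destruct in_dec; [discriminate|contradiction].
    + apply seq_NoDup.
    + intros j; rewrite in_app_iff, in_seq; unfold rest; rewrite filter_In, in_seq.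
      split.
      * intros [Hj|[Hj _]]; [specialize (HN j Hj)|]; lia.
      * intros Hj; destruct (in_dec Nat.eq_dec j q); [now left|now right].
  - rewrite map_app; eapply S4; [apply S2|].
    rewrite <- (length_map (nth_obj Phi) q); apply S9, H.
Qed.

Lemma map_nth_seq (Phi Psi Xi : list obj) k n :
  k = length Phi -> n = length Psi ->
  map (nth_obj (Phi ++ Psi ++ Xi)) (seq k n) = Psi.
Proof.
  intros -> ->; revert Phi; induction Psi as [|o Psi IH]; intros Phi; [reflexivity|]; cbn.
  rewrite app_nth2, Nat.sub_diag by lia; cbn; f_equal.
  specialize (IH (Phi ++ [o])); rewrite length_app, <- app_assoc in IH; cbn in IH.
  now rewrite Nat.add_1_r in IH.
Qed.

Lemma map_nth_seq0 (Psi Xi : list obj) n :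
  n = length Psi -> map (nth_obj (Psi ++ Xi)) (seq 0 n) = Psi.
Proof. exact (map_nth_seq [] Psi Xi 0 n eq_refl). Qed.

Lemma kleene_swap_blocks n a b m e : exists e', forall Xi A B D y,
  length Xi = n -> length A = a -> length B = b -> length D = m ->
  Kleene e (Xi ++ A ++ B ++ D) y -> Kleene e' (Xi ++ B ++ A ++ D) y.
Proof.
  destruct (kleene_select (n + b + a + m)
    (seq 0 n ++ seq (n + b) a ++ seq n b ++ seq (n + b + a) m) e) as [e' He'].
  - repeat apply NoDup_app; try apply seq_NoDup;
      intros j; rewrite ?in_app_iff, !in_seq; lia.
  - intros j; rewrite !in_app_iff, !in_seq; lia.
  - exists e'; intros Xi A B D y <- <- <- <- H; apply He'.
    + rewrite !length_app; lia.
    + rewrite !map_app.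
      rewrite map_nth_seq0 by reflexivity.
      pose proof (map_nth_seq Xi B (A ++ D) _ _ eq_refl eq_refl) as EB.
      pose proof (map_nth_seq (Xi ++ B) A D _ _ eq_refl eq_refl) as EA.
      pose proof (map_nth_seq (Xi ++ B ++ A) D [] _ _ eq_refl eq_refl) as ED.
      rewrite app_nil_r in ED.
      rewrite !length_app, <- !app_assoc, ?Nat.add_assoc in *.
      rewrite EB, EA, ED; exact H.
Qed.

Lemma kleene_swap n m e : exists e', forall Phi Psi y,
  length Phi = n -> length Psi = m -> Kleene e (Phi ++ Psi) y -> Kleene e' (Psi ++ Phi) y.
Proof.
  destruct (kleene_swap_blocks 0 n m 0 e) as [e' He'].
  exists e'; intros Phi Psi y Hn Hm H.
  specialize (He' [] Phi Psi [] y eq_refl Hn Hm eq_refl); rewrite !app_nil_r in He'.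
  exact (He' H).
Qed.

(** The clauses of S1-S9 act on the front of the list of arguments.  With the fixed objects at the
end, the front is free for the numbers and functions that a program introduces. *)
Lemma computable_in_swap Th s (T : interp s) :
  computable_in Th s T <->
  exists e, forall xi : env (args s), Kleene e (objs xi ++ Th) (apply s T xi).
Proof.
  split; intros [e He].
  - destruct (kleene_swap (length Th) (length (args s)) e) as [e' He'].
    exists e'; intros xi; apply He'; [reflexivity|apply objs_length|apply He].
  - destruct (kleene_swap (length (args s)) (length Th) e) as [e' He'].
    exists e'; intros xi; apply He'; [apply objs_length|reflexivity|apply He].
Qed.

(** * Families of numbers computable from an object and E2 *)

(** One index computes the whole family.  The context [l] holds the variables of a program; [o] will
be the given solution functional, and E2 is always at hand. *)
Definition Computable (o : obj) (l : list ty) (phi : env l -> nat) : Prop :=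
  exists e, forall xi, Kleene e (objs xi ++ [o; Obj ty2 E2]) (phi xi).

Lemma computable_ext o l (phi psi : env l -> nat) :
  (forall xi, psi xi = phi xi) -> Computable o l phi -> Computable o l psi.
Proof. intros E [e He]; exists e; intros xi; rewrite E; apply He. Qed.

Lemma computable_const o l n : Computable o l (fun _ => n).
Proof. exists (code [2%nat; n]); intros xi; apply S2. Qed.

Lemma computable_var0 o l : Computable o (Nat :: l) (fun xi => fst xi).
Proof. exists (code [3%nat]); intros xi; apply S3. Qed.

Lemma computable_weaken o l s (phi : env l -> nat) (psi : env (s :: l) -> nat) :
  Computable o l phi -> (forall a xi, psi (a, xi) = phi xi) -> Computable o (s :: l) psi.
Proof.
  intros [e He] E.
  destruct (kleene_select (S (length l + 2)) (seq 1 (length l + 2)) e) as [e' He'].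
  - apply seq_NoDup.
  - intros j; rewrite in_seq; lia.
  - exists e'; intros [a xi]; rewrite E; apply He'.
    + cbn; now rewrite length_app, objs_length.
    + cbn [objs app fst snd].
      rewrite <- (app_nil_r (_ ++ [o; Obj ty2 E2])).
      change (?h :: ?L) with ([h] ++ L); rewrite (map_nth_seq [Obj s a]).
      * apply He.
      * reflexivity.
      * now rewrite length_app, objs_length.
Qed.

Lemma computable_let o l (phi : env l -> nat) (psi : env (Nat :: l) -> nat) :
  Computable o l phi -> Computable o (Nat :: l) psi -> Computable o l (fun xi => psi (phi xi, xi)).
Proof.
  intros [e He] [d Hd]; exists (code [4%nat; d; e]); intros xi.
  eapply S4; [apply He|apply (Hd (phi xi, xi))].
Qed.

Lemma computable_rec o l (n : env l -> nat) (g : env l -> nat) (h : env (Nat :: Nat :: l) -> nat) :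
  Computable o l n -> Computable o l g -> Computable o (Nat :: Nat :: l) h ->
  Computable o l (fun xi => nat_rect (fun _ => nat) (g xi) (fun m y => h (m, (y, xi))) (n xi)).
Proof.
  intros Hn [e He] [d Hd].
  apply (computable_let o l n (fun xi => nat_rect (fun _ => nat) (g (snd xi))
           (fun m y => h (m, (y, snd xi))) (fst xi)) Hn).
  exists (code [5%nat; e; d]); intros [m xi]; cbn [fst snd objs app].
  induction m as [|m IH]; cbn [nat_rect].
  - apply S5_0, He.
  - eapply S5_S; [exact IH|].
    exact (Hd (m, (nat_rect (fun _ => nat) (g xi) (fun m y => h (m, (y, xi))) m, xi))).
Qed.

Definition Argument (o : obj) (l : list ty) (s : ty) (h : env l -> interp s) : Prop :=
  exists k, forall xi, nth_error (objs xi ++ [o; Obj ty2 E2]) k = Some (Obj s (h xi)).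

Lemma argument_param s x l : Argument (Obj s x) l s (fun _ => x).
Proof.
  exists (length l); intros xi.
  now rewrite nth_error_app2, objs_length, Nat.sub_diag by (rewrite objs_length; lia).
Qed.

Lemma argument_E2 o l : Argument o l ty2 (fun _ => E2).
Proof.
  exists (S (length l)); intros xi.
  rewrite nth_error_app2, objs_length by (rewrite objs_length; lia).
  replace (S (length l) - length l)%nat with 1%nat by lia; reflexivity.
Qed.

Lemma argument_head o l s : Argument o (s :: l) s (fun xi => fst xi).
Proof. now exists 0%nat. Qed.

Lemma argument_tail o l s t h g :
  Argument o l s h -> (forall a xi, g (a, xi) = h xi) -> Argument o (t :: l) s g.
Proof. intros [k Hk] E; exists (S k); intros [a xi]; rewrite E; apply Hk. Qed.

Ltac var := first [assumption | apply argument_head |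
  eapply argument_tail; cycle 1; [intros ? ?; cbn [fst snd]; reflexivity|var]].

Fixpoint take (l l' : list ty) : env (l ++ l') -> env l :=
  match l with
  | [] => fun _ => tt
  | s :: l => fun xi => (fst xi, take l l' (snd xi))
  end.

Fixpoint drop (l l' : list ty) : env (l ++ l') -> env l' :=
  match l with
  | [] => fun xi => xi
  | s :: l => fun xi => drop l l' (snd xi)
  end.

Fixpoint join (l l' : list ty) : env l -> env l' -> env (l ++ l') :=
  match l with
  | [] => fun _ xi => xi
  | s :: l => fun zeta xi => (fst zeta, join l l' (snd zeta) xi)
  end.

Lemma take_join l l' zeta xi : take l l' (join l l' zeta xi) = zeta.
Proof.
  induction l as [|s l IH]; cbn; [now destruct zeta|].
  rewrite IH; now destruct zeta.
Qed.

Lemma drop_join l l' zeta xi : drop l l' (join l l' zeta xi) = xi.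
Proof. induction l as [|s l IH]; cbn; auto. Qed.

Lemma join_take_drop l l' zeta : join l l' (take l l' zeta) (drop l l' zeta) = zeta.
Proof. induction l as [|s l IH]; cbn; [|rewrite IH; destruct zeta]; reflexivity. Qed.

Lemma objs_join l l' zeta xi : objs (join l l' zeta xi) = objs zeta ++ objs xi.
Proof. induction l as [|s l IH]; cbn; [|rewrite IH]; auto. Qed.

(** By currying, a family of functionals is a family of numbers in a longer context; this is the
shape of the inner computations of S8. *)
Definition ComputableF (o : obj) (l : list ty) (t : ty) (g : env l -> interp t) : Prop :=
  Computable o (args t ++ l) (fun zeta => apply t (g (drop _ _ zeta)) (take _ _ zeta)).

Fixpoint ComputableArgs o l (ts : list ty) : (env l -> env ts) -> Prop :=
  match ts with
  | [] => fun _ => True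
  | t :: ts => fun G =>
      ComputableF o l t (fun xi => fst (G xi)) /\ ComputableArgs o l ts (fun xi => snd (G xi))
  end.

(** A family of functionals that may be applied to computable arguments.  [ComputableF] does not
give this: applying a computed functional of higher type would be a substitution.  It holds of
the objects in the context and of their applications, and that is all the programs below need. *)
Definition Applicable (o : obj) (l : list ty) (s : ty) (h : env l -> interp s) : Prop :=
  forall G, ComputableArgs o l (args s) G -> Computable o l (fun xi => apply s (h xi) (G xi)).

Lemma applicable_app o l s t h g :
  Applicable o l (Arr s t) h -> ComputableF o l s g -> Applicable o l t (fun xi => h xi (g xi)).
Proof. intros Hh Hg G HG; exact (Hh (fun xi => (g xi, G xi)) (conj Hg HG)). Qed.

Lemma applicable_nat o l h : Applicable o l Nat h -> Computable o l h.
Proof. intros H; exact (H (fun _ => tt) I). Qed.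

(** S8 applies the first argument and keeps it in front of the remaining ones in the inner
computations, while these were given with that argument in its place, at position [k]. *)
Lemma inner_indices o l k ts (G : env l -> env ts) :
  ComputableArgs o l ts G -> exists es, length es = length ts /\
  forall xi Phi1 Psi Phi2, objs xi ++ [o; Obj ty2 E2] = Phi1 ++ Psi :: Phi2 ->
  length Phi1 = k ->
  forall j e t (g : interp t),
    nth_error es j = Some e -> nth_error (objs (G xi)) j = Some (Obj t g) ->
    forall zeta : env (args t),
      Kleene e (objs zeta ++ Psi :: Phi1 ++ Phi2) (apply t g zeta).
Proof.
  induction ts as [|t ts IH]; cbn; intros HG.
  - exists []; split; [reflexivity|]. intros xi Phi1 Psi Phi2 _ _ [|j] e t g He; discriminate He.
  - destruct HG as [[e He] HG]; destruct (IH _ HG) as (es & Hes & H).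
    destruct (kleene_swap_blocks (length (args t)) k 1 (length l + 1 - k) e) as [e' He'].
    exists (e' :: es); split; [cbn; now rewrite Hes|].
    intros xi Phi1 Psi Phi2 E Hk [|j] d t' g Hd Hg zeta.
    + cbn in Hd, Hg; injection Hd as <-.
      assert (E' : Obj t (fst (G xi)) = Obj t' g)
        by exact (f_equal (fun x => match x with Some a => a | None => Psi end) Hg).
      (* the equation is one between objects, whose types are part of it *)
      revert zeta.
      set (P := fun ob : obj => forall zeta : env (args (otype ob)),
        Kleene e' (objs zeta ++ Psi :: Phi1 ++ Phi2) (apply (otype ob) (oval ob) zeta)).
      change (P (Obj t' g)); rewrite <- E'; intros zeta; cbn [otype oval] in *.
      apply (He' (objs zeta) Phi1 [Psi] Phi2).
      * apply objs_length.
      * exact Hk.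
      * reflexivity.
      * apply (f_equal (@length obj)) in E; rewrite !length_app, objs_length in E; cbn in E; lia.
      * cbn [app]; rewrite <- E, app_assoc, <- objs_join.
        specialize (He (join _ _ zeta xi)); rewrite take_join, drop_join in He; exact He.
    + exact (H xi Phi1 Psi Phi2 E Hk j d t' g Hd Hg zeta).
Qed.

Lemma applicable_var o l s h : Argument o l s h -> Applicable o l s h.
Proof.
  intros [k Hk] G HG.
  destruct (inner_indices o l k _ G HG) as (es & Hes & H).
  destruct (kleene_swap_blocks 0 1 k (length l + 1 - k) (code (8%nat :: es))) as [e' He'].
  exists e'; intros xi.
  destruct (nth_error_split _ _ (Hk xi)) as (Phi1 & Phi2 & E & Hl).
  rewrite E. apply (He' [] [_] Phi1 Phi2).
  - reflexivity.
  - reflexivity.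
  - exact Hl.
  - apply (f_equal (@length obj)) in E; rewrite !length_app, objs_length in E; cbn in E; lia.
  - apply S8; [exact Hes|]. exact (H xi Phi1 _ Phi2 E Hl).
Qed.

(** * Predicates decided by E2, and search *)

Definition ind (P : Prop) : nat := if excluded_middle_informative P then 0%nat else 1%nat.

Ltac em_cases := repeat match goal with
  | |- context [excluded_middle_informative ?P] => destruct (excluded_middle_informative P)
  end.

Lemma ind_true P : P -> ind P = 0%nat.
Proof. unfold ind; destruct excluded_middle_informative; tauto. Qed.

Lemma ind_false P : ~ P -> ind P = 1%nat.
Proof. unfold ind; destruct excluded_middle_informative; tauto. Qed.

Lemma ind_iff P Q : (P <-> Q) -> ind P = ind Q.
Proof. intros E; unfold ind; em_cases; tauto. Qed.

Definition Decidable (o : obj) (l : list ty) (P : env l -> Prop) : Prop :=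
  Computable o l (fun xi => ind (P xi)).

Ltac weaken := eapply computable_weaken; cycle 1; [intros ? ?; cbn [fst snd]; reflexivity|].

Lemma computable_S o l f : Computable o l f -> Computable o l (fun xi => S (f xi)).
Proof.
  intros Hf; apply (computable_let o l f (fun xi => S (fst xi)) Hf).
  exists (code [1%nat]); intros xi; apply S1.
Qed.

Lemma computable_pred o l f : Computable o l f -> Computable o l (fun xi => pred (f xi)).
Proof.
  intros Hf; eapply computable_ext;
    [|apply (computable_rec o l f (fun _ => 0%nat) (fun p => fst p) Hf (computable_const _ _ _)), computable_var0].
  intros xi; cbn; destruct (f xi); reflexivity.
Qed.

Lemma computable_add o l f g : Computable o l f -> Computable o l g ->
  Computable o l (fun xi => f xi + g xi)%nat.
Proof.
  intros Hf Hg; eapply computable_ext;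
    [|apply (computable_rec o l f g (fun p => S (fst (snd p))) Hf Hg), computable_S;
      weaken; apply computable_var0].
  intros xi; cbn; induction (f xi); cbn; congruence.
Qed.

Lemma computable_mul o l f g : Computable o l f -> Computable o l g ->
  Computable o l (fun xi => f xi * g xi)%nat.
Proof.
  intros Hf Hg; eapply computable_ext;
    [|apply (computable_rec o l f (fun _ => 0%nat) (fun p => g (snd (snd p)) + fst (snd p))%nat Hf);
      [apply computable_const|apply computable_add; weaken; [weaken; exact Hg|apply computable_var0]]].
  intros xi; cbn; induction (f xi); cbn; congruence.
Qed.

Lemma computable_sub o l f g : Computable o l f -> Computable o l g ->
  Computable o l (fun xi => f xi - g xi)%nat.
Proof.
  intros Hf Hg; eapply computable_ext;
    [|apply (computable_rec o l g f (fun p => pred (fst (snd p))) Hg Hf), computable_pred;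
      weaken; apply computable_var0].
  intros xi; cbn; induction (g xi) as [|n IH]; cbn; [lia|]. rewrite <- IH; lia.
Qed.

Lemma computable_pow2 o l f : Computable o l f -> Computable o l (fun xi => 2 ^ f xi)%nat.
Proof.
  intros Hf; eapply computable_ext;
    [|apply (computable_rec o l f (fun _ => 1%nat) (fun p => fst (snd p) + fst (snd p))%nat Hf);
      [apply computable_const|apply computable_add; weaken; apply computable_var0]].
  intros xi; cbn; induction (f xi) as [|n IH]; cbn; [reflexivity|]. rewrite <- IH; lia.
Qed.

Lemma computable_if o l P f g : Decidable o l P -> Computable o l f -> Computable o l g ->
  Computable o l (fun xi => if excluded_middle_informative (P xi) then f xi else g xi).
Proof.
  intros HP Hf Hg; eapply computable_ext;
    [|apply (computable_rec o l _ f (fun p => g (snd (snd p))) HP Hf); weaken; weaken; exact Hg].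
  intros xi; unfold ind; cbn; destruct excluded_middle_informative; reflexivity.
Qed.

Lemma decidable_iff o l (P Q : env l -> Prop) :
  (forall xi, Q xi <-> P xi) -> Decidable o l P -> Decidable o l Q.
Proof. intros E; apply computable_ext; intros xi; apply ind_iff, E. Qed.

Lemma decidable_weaken o l s (P : env l -> Prop) (Q : env (s :: l) -> Prop) :
  Decidable o l P -> (forall a xi, Q (a, xi) = P xi) -> Decidable o (s :: l) Q.
Proof. intros HP E; eapply computable_weaken; [exact HP|]; intros a xi; now rewrite E. Qed.

Lemma decidable_const o l (P : Prop) : Decidable o l (fun _ => P).
Proof. exact (computable_const o l (ind P)). Qed.

Lemma decidable_and o l P Q : Decidable o l P -> Decidable o l Q ->
  Decidable o l (fun xi => P xi /\ Q xi).
Proof.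
  intros HP HQ; eapply computable_ext; [|exact (computable_if o l P _ _ HP HQ (computable_const o l 1%nat))].
  intros xi; unfold ind; cbv beta; em_cases; tauto.
Qed.

Lemma decidable_not o l P : Decidable o l P -> Decidable o l (fun xi => ~ P xi).
Proof.
  intros HP; eapply computable_ext;
    [|exact (computable_if o l P _ _ HP (computable_const o l 1%nat) (computable_const o l 0%nat))].
  intros xi; unfold ind; cbv beta; em_cases; tauto.
Qed.

Lemma decidable_or o l P Q : Decidable o l P -> Decidable o l Q ->
  Decidable o l (fun xi => P xi \/ Q xi).
Proof.
  intros HP HQ; apply (decidable_iff o l (fun xi => ~ (~ P xi /\ ~ Q xi)));
    [intros xi; tauto|now apply decidable_not, decidable_and; apply decidable_not].
Qed.

Lemma decidable_imp o l P Q : Decidable o l P -> Decidable o l Q -> Decidable o l (fun xi => P xi ->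
  Q xi).
Proof.
  intros HP HQ; apply (decidable_iff o l (fun xi => ~ P xi \/ Q xi));
    [intros xi; tauto|now apply decidable_or; [apply decidable_not|]].
Qed.

Lemma decidable_eq0 o l f : Computable o l f -> Decidable o l (fun xi => f xi = 0%nat).
Proof.
  intros Hf; eapply computable_ext;
    [|apply (computable_rec o l f (fun _ => 0%nat) (fun _ => 1%nat) Hf); apply computable_const].
  intros xi; cbn; destruct (f xi); cbn; [now apply ind_true|now apply ind_false].
Qed.

Lemma decidable_le o l f g : Computable o l f -> Computable o l g ->
  Decidable o l (fun xi => (f xi <= g xi)%nat).
Proof.
  intros Hf Hg; apply (decidable_iff o l (fun xi => (f xi - g xi = 0)%nat));
    [intros; lia|now apply decidable_eq0, computable_sub].
Qed.

Lemma decidable_eq o l f g : Computable o l f -> Computable o l g ->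
  Decidable o l (fun xi => f xi = g xi).
Proof.
  intros Hf Hg; apply (decidable_iff o l (fun xi => (f xi <= g xi)%nat /\ (g xi <= f xi)%nat));
    [intros; lia|now apply decidable_and; apply decidable_le].
Qed.

(** This is what E2 is for: it is applied to the characteristic function of the matrix. *)
Lemma decidable_ex o l (P : env l -> nat -> Prop) :
  Decidable o (Nat :: l) (fun p => P (snd p) (fst p)) -> Decidable o l (fun xi => exists n, P xi n).
Proof.
  intros HP.
  eapply computable_ext; [|apply applicable_nat, (applicable_app o l (Arr Nat Nat) Nat (fun _ => E2)
                       (fun xi n => ind (P xi n)))].
  - intros xi; apply ind_iff; split; intros [n Hn]; exists n;
      [now apply ind_true|revert Hn; unfold ind; destruct excluded_middle_informative; easy].
  - apply applicable_var, argument_E2.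
  - exact HP.
Qed.

Lemma decidable_all o l (P : env l -> nat -> Prop) :
  Decidable o (Nat :: l) (fun p => P (snd p) (fst p)) -> Decidable o l (fun xi => forall n, P xi n).
Proof.
  intros HP; apply (decidable_iff o l (fun xi => ~ exists n, ~ P xi n)).
  - intros xi; split; [intros H [n Hn]; auto|].
    intros H n; apply NNPP; intros Hn; eauto.
  - now apply decidable_not, (decidable_ex o l (fun xi n => ~ P xi n)), decidable_not.
Qed.

Lemma least_exists (P : nat -> Prop) n :
  P n -> exists m, P m /\ forall k, (k < m)%nat -> ~ P k.
Proof.
  intros Hn; apply NNPP; intros Hno. revert Hn.
  induction n as [n IH] using lt_wf_ind; intros Hn.
  apply Hno; exists n; split; [exact Hn|exact IH].
Qed.

(** The value is 0 if [P] holds nowhere.  With the second disjunct the search has a target in every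
case, as totality requires, and E2 decides that disjunct. *)
Definition least (P : nat -> Prop) : nat :=
  epsilon (inhabits 0%nat)
    (fun m => (P m \/ (forall n, ~ P n)) /\ forall k, (k < m)%nat -> ~ (P k \/ (forall n, ~ P n))).

Lemma least_spec (P : nat -> Prop) :
  (P (least P) \/ (forall n, ~ P n)) /\
  forall k, (k < least P)%nat -> ~ (P k \/ (forall n, ~ P n)).
Proof.
  unfold least; apply epsilon_spec.
  destruct (classic (exists n, P n)) as [[n Hn]|Hno].
  - apply (least_exists (fun m => P m \/ (forall n, ~ P n)) n); now left.
  - apply (least_exists (fun m => P m \/ (forall n, ~ P n)) 0%nat); right; eauto.
Qed.

Lemma least_correct (P : nat -> Prop) n : P n -> P (least P).
Proof. intros Hn; destruct (proj1 (least_spec P)) as [|H]; [easy|now apply H in Hn]. Qed.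

(** E2 only answers with bits, so a number has to be found by a search that no recursion of S5
bounds.  The index [D] takes itself and the current candidate as its first two arguments, and S9
restarts it on the next candidate.  Recursion by S5 on the bit that says whether the candidate
fails is a lazy case distinction: the restart belongs to the successor case. *)
Lemma kleene_search o l (P : env (Nat :: l) -> Prop) :
  Decidable o (Nat :: l) P ->
  exists e, forall xi m, P (m, xi) -> (forall k, (k < m)%nat -> ~ P (k, xi)) ->
    Kleene e (objs xi ++ [o; Obj ty2 E2]) m.
Proof.
  intros HP.
  assert (Hc : Computable o (Nat :: Nat :: l) (fun xi => ind (P (snd xi)))) by (weaken; exact HP).
  assert (Hn : Computable o (Nat :: Nat :: l) (fun xi => fst (snd xi))) by (weaken; apply computable_var0).
  assert (Hs : Computable o (Nat :: Nat :: Nat :: Nat :: l) (fun xi => S (fst (snd (snd (snd xi))))))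
    by (apply computable_S; weaken; weaken; weaken; apply computable_var0).
  assert (Hd : Computable o (Nat :: Nat :: Nat :: Nat :: Nat :: l) (fun xi => fst (snd (snd (snd xi)))))
    by (weaken; weaken; weaken; apply computable_var0).
  destruct Hc as [c Hc], Hn as [e1 Hn], Hs as [s Hs], Hd as [d Hd].
  destruct (kleene_select (6 + (length l + 2)) (0 :: 4 :: 1 :: seq 6 (length l + 2))%nat
              (code [9%nat; (2 + (length l + 2))%nat])) as [h Hh].
  { repeat constructor; cbn; rewrite ?in_seq; try lia. apply seq_NoDup. }
  { intros j; cbn; rewrite in_seq; lia. }
  set (D := code [4%nat; code [5%nat; e1; code [4%nat; code [4%nat; h; d]; s]]; c]).
  exists (code [4%nat; code [4%nat; D; code [2%nat; D]]; code [2%nat; 0%nat]]).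
  intros xi m Hm Hmin; set (Phi := objs xi ++ [o; Obj ty2 E2]).
  assert (HPhi : length Phi = (length l + 2)%nat)
    by (unfold Phi; now rewrite length_app, objs_length).
  assert (H : forall j n, (n + j = m)%nat -> Kleene D (Obj Nat D :: Obj Nat n :: Phi) m).
  { induction j as [|j IH]; intros n Hj.
    - assert (n = m) as -> by lia.
      eapply S4; [exact (Hc (D, (m, xi)))|]; cbn [snd]; rewrite ind_true by assumption.
      apply S5_0, (Hn (D, (m, xi))).
    - eapply S4; [exact (Hc (D, (n, xi)))|]; cbn [snd].
      rewrite ind_false by (apply Hmin; lia).
      eapply S5_S; [exact (S5_0 _ _ _ _ (Hn (D, (n, xi))))|].
      eapply S4; [exact (Hs (0%nat, (n, (D, (n, xi)))))|].
      eapply S4; [exact (Hd (S n, (0%nat, (n, (D, (n, xi))))))|].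
      cbn [fst snd]; fold Phi; apply Hh; [cbn [objs app length]; fold Phi; now rewrite <- HPhi|].
      pose proof (S9 D (Obj Nat D :: Obj Nat (S n) :: Phi) [] m (IH (S n) ltac:(lia))) as H9.
      rewrite app_nil_r in H9; cbn [length] in H9; rewrite HPhi in H9.
      cbn [map objs app fst snd]; fold Phi.
      pose proof (map_nth_seq [Obj Nat D; Obj Nat (S n); Obj Nat 0%nat; Obj Nat n; Obj Nat D; Obj Nat n]
                    Phi [] 6 (length l + 2)%nat eq_refl (eq_sym HPhi)) as E.
      rewrite app_nil_r in E; cbn [app] in E; rewrite E; exact H9. }
  (* the search starts at 0, with [D] handed to itself *)
  eapply S4; [apply S2|]. eapply S4; [apply S2|]. exact (H m 0%nat eq_refl).
Qed.

Lemma computable_least o l (P : env l -> nat -> Prop) :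
  Decidable o (Nat :: l) (fun p => P (snd p) (fst p)) -> Computable o l (fun xi => least (P xi)).
Proof.
  intros HP.
  destruct (kleene_search o l (fun p => P (snd p) (fst p) \/ forall n, ~ P (snd p) n)) as [e He].
  - apply decidable_or; [exact HP|].
    apply (decidable_weaken o l Nat (fun xi => forall n, ~ P xi n)); [|reflexivity].
    now apply (decidable_all o l (fun xi n => ~ P xi n)), decidable_not.
  - exists e; intros xi; apply He; apply (least_spec (P xi)).
Qed.

(** Spares programming arithmetic by primitive recursion: the inverse of the pairing function, say,
is found by its graph. *)
Lemma computable_graph o l (f : env l -> nat) (P : env l -> nat -> Prop) :
  Decidable o (Nat :: l) (fun p => P (snd p) (fst p)) ->
  (forall xi n, P xi n <-> n = f xi) -> Computable o l f.
Proof.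
  intros HP H; eapply computable_ext; [|exact (computable_least o l P HP)].
  intros xi; symmetry; apply H, (least_correct _ (f xi)), H; reflexivity.
Qed.

(** * Rational arithmetic on codes *)

Lemma computable_pair o l f g : Computable o l f -> Computable o l g ->
  Computable o l (fun xi => Cantor.to_nat (f xi, g xi)).
Proof.
  intros Hf Hg.
  apply (computable_graph o l _ (fun xi n => n * 2 = g xi * 2 + (g xi + f xi) * S (g xi + f xi))%nat).
  - assert (Hf' : Computable o (Nat :: l) (fun p => f (snd p))) by (weaken; exact Hf).
    assert (Hg' : Computable o (Nat :: l) (fun p => g (snd p))) by (weaken; exact Hg).
    assert (Computable o (Nat :: l) (fun p => g (snd p) + f (snd p))%nat) by now apply computable_add.
    apply decidable_eq; [apply computable_mul; [apply computable_var0|apply computable_const]|].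
    apply computable_add; apply computable_mul; try apply computable_S; auto using computable_const.
  - intros xi n; pose proof (Cantor.to_nat_spec (f xi) (g xi)); lia.
Qed.

Lemma computable_fst o l f : Computable o l f ->
  Computable o l (fun xi => fst (Cantor.of_nat (f xi))).
Proof.
  intros Hf.
  apply (computable_graph o l _ (fun xi n => exists m, Cantor.to_nat (n, m) = f xi)).
  - apply (decidable_ex o (Nat :: l) (fun p m => Cantor.to_nat (fst p, m) = f (snd p))).
    apply decidable_eq; [apply computable_pair; [weaken|]; apply computable_var0|weaken; weaken; exact Hf].
  - intros xi n; split.
    + intros [m <-]; now rewrite Cantor.cancel_of_to.
    + intros ->; exists (snd (Cantor.of_nat (f xi))).
      now rewrite <- surjective_pairing, Cantor.cancel_to_of.
Qed.

Lemma computable_snd o l f : Computable o l f ->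
  Computable o l (fun xi => snd (Cantor.of_nat (f xi))).
Proof.
  intros Hf.
  apply (computable_graph o l _ (fun xi n => exists m, Cantor.to_nat (m, n) = f xi)).
  - apply (decidable_ex o (Nat :: l) (fun p m => Cantor.to_nat (m, fst p) = f (snd p))).
    apply decidable_eq; [apply computable_pair; [|weaken]; apply computable_var0|weaken; weaken; exact Hf].
  - intros xi n; split.
    + intros [m <-]; now rewrite Cantor.cancel_of_to.
    + intros ->; exists (fst (Cantor.of_nat (f xi))).
      now rewrite <- surjective_pairing, Cantor.cancel_to_of.
Qed.

Definition mkrat (p q d : nat) : nat := Cantor.to_nat (Cantor.to_nat (p, q), d).

Lemma rat_mkrat p q d : rat (mkrat p q d) = (INR p - INR q) / INR (S d).
Proof. unfold rat, mkrat; now rewrite !Cantor.cancel_of_to. Qed.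

Definition pos_part (c : nat) : nat := fst (Cantor.of_nat (fst (Cantor.of_nat c))).
Definition neg_part (c : nat) : nat := snd (Cantor.of_nat (fst (Cantor.of_nat c))).
Definition den (c : nat) : nat := S (snd (Cantor.of_nat c)).

Lemma rat_parts c : rat c = (INR (pos_part c) - INR (neg_part c)) / INR (den c).
Proof.
  unfold rat, pos_part, neg_part, den.
  now destruct (Cantor.of_nat c) as [a b]; cbn [fst snd]; destruct (Cantor.of_nat a).
Qed.

Lemma den_pos c : 0 < INR (den c).
Proof. apply lt_0_INR; unfold den; lia. Qed.

Lemma rat_le c c' :
  rat c <= rat c' <->
  (pos_part c * den c' + neg_part c' * den c <= pos_part c' * den c + neg_part c * den c')%nat.
Proof.
  rewrite !rat_parts. pose proof (den_pos c) as H; pose proof (den_pos c') as H'.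
  split.
  - intros E; apply INR_le; rewrite !plus_INR, !mult_INR.
    apply (Rmult_le_compat_r (INR (den c) * INR (den c'))) in E;
      [|apply Rlt_le, Rmult_lt_0_compat; assumption].
    field_simplify in E; lra.
  - intros E; apply le_INR in E; rewrite !plus_INR, !mult_INR in E.
    apply (Rmult_le_reg_r (INR (den c) * INR (den c')));
      [apply Rmult_lt_0_compat; assumption|].
    field_simplify; lra.
Qed.

Definition ComputableR (o : obj) (l : list ty) (v : env l -> R) : Prop :=
  exists phi, Computable o l phi /\ forall xi, rat (phi xi) = v xi.

Lemma computableR_rat o l phi : Computable o l phi -> ComputableR o l (fun xi => rat (phi xi)).
Proof. intros H; now exists phi. Qed.

Lemma computable_pos_part o l f : Computable o l f -> Computable o l (fun xi => pos_part (f xi)).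
Proof. intros H; apply computable_fst, computable_fst, H. Qed.

Lemma computable_neg_part o l f : Computable o l f -> Computable o l (fun xi => neg_part (f xi)).
Proof. intros H; apply computable_snd, computable_fst, H. Qed.

Lemma computable_den o l f : Computable o l f -> Computable o l (fun xi => den (f xi)).
Proof. intros H; apply computable_S, computable_snd, H. Qed.

#[local] Hint Resolve computable_pos_part computable_neg_part computable_den computable_add
  computable_mul computable_pred computable_pair computable_const computable_S computable_pow2 : comp.

Lemma computableR_ext o l v w : (forall xi, w xi = v xi) -> ComputableR o l v -> ComputableR o l w.
Proof. intros E [f [Hf Ef]]; exists f; split; [exact Hf|]; intros xi; now rewrite E. Qed.

Lemma computableR_opp o l v : ComputableR o l v -> ComputableR o l (fun xi => - v xi).
Proof.
  intros [f [Hf Ef]].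
  exists (fun xi => mkrat (neg_part (f xi)) (pos_part (f xi)) (pred (den (f xi)))); split.
  - unfold mkrat; auto with comp.
  - intros xi; rewrite <- Ef, rat_mkrat, rat_parts.
    change (S (pred (den (f xi)))) with (den (f xi)).
    pose proof (den_pos (f xi)); field; lra.
Qed.

Lemma computableR_plus o l v w : ComputableR o l v -> ComputableR o l w ->
  ComputableR o l (fun xi => v xi + w xi).
Proof.
  intros [f [Hf Ef]] [g [Hg Eg]].
  exists (fun xi => mkrat (pos_part (f xi) * den (g xi) + pos_part (g xi) * den (f xi))
                          (neg_part (f xi) * den (g xi) + neg_part (g xi) * den (f xi))
                          (pred (den (f xi) * den (g xi)))); split.
  - unfold mkrat; auto 8 with comp.
  - intros xi; rewrite <- Ef, <- Eg, rat_mkrat, !rat_parts.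
    replace (S (pred (den (f xi) * den (g xi)))) with (den (f xi) * den (g xi))%nat
      by (unfold den; lia).
    rewrite !plus_INR, !mult_INR.
    pose proof (den_pos (f xi)); pose proof (den_pos (g xi)); field; lra.
Qed.

Lemma computableR_minus o l v w : ComputableR o l v -> ComputableR o l w ->
  ComputableR o l (fun xi => v xi - w xi).
Proof. intros Hv Hw; apply computableR_plus; [exact Hv|now apply computableR_opp]. Qed.

(** The code of 2^-k. *)
Definition half_power (k : nat) : nat := mkrat 1 0 (pred (2 ^ k)).

Lemma rat_half_power k : rat (half_power k) = / 2 ^ k.
Proof.
  unfold half_power; rewrite rat_mkrat.
  rewrite Nat.succ_pred by (apply Nat.pow_nonzero; lia).
  rewrite pow_INR. change (INR 1) with 1; change (INR 0) with 0; change (INR 2) with 2.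
  field; apply pow_nonzero; lra.
Qed.

Lemma computable_half_power o l f : Computable o l f ->
  Computable o l (fun xi => half_power (f xi)).
Proof. intros Hf; unfold half_power, mkrat; auto 8 with comp. Qed.

Lemma computableR_half_power o l f : Computable o l f -> ComputableR o l (fun xi => / 2 ^ f xi).
Proof.
  intros Hf; exists (fun xi => half_power (f xi)); split; [now apply computable_half_power|].
  intros xi; apply rat_half_power.
Qed.

Lemma rat_0 : rat 0 = 0.
Proof. unfold rat; cbn; lra. Qed.

Lemma computableR_0 o l : ComputableR o l (fun _ => 0).
Proof. exists (fun _ => 0%nat); split; [apply computable_const|intros _; apply rat_0]. Qed.

Lemma computableR_1 o l : ComputableR o l (fun _ => 1).
Proof.
  apply (computableR_ext o l (fun _ => / 2 ^ 0)); [intros _; cbn; lra|].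
  apply computableR_half_power, computable_const.
Qed.

Lemma decidable_Rle o l v w : ComputableR o l v -> ComputableR o l w ->
  Decidable o l (fun xi => v xi <= w xi).
Proof.
  intros [f [Hf Ef]] [g [Hg Eg]].
  eapply decidable_iff; [intros xi; rewrite <- Ef, <- Eg; apply rat_le|].
  apply decidable_le; auto 8 with comp.
Qed.

Lemma decidable_Rlt o l v w : ComputableR o l v -> ComputableR o l w ->
  Decidable o l (fun xi => v xi < w xi).
Proof.
  intros Hv Hw; apply (decidable_iff o l (fun xi => ~ w xi <= v xi)); [intros xi; split; lra|].
  now apply decidable_not, decidable_Rle.
Qed.

Lemma decidable_Rabs_le o l v w :
  ComputableR o l v -> ComputableR o l w -> Decidable o l (fun xi => Rabs (v xi) <= w xi).
Proof.
  intros Hv Hw; apply (decidable_iff o l (fun xi => - w xi <= v xi /\ v xi <= w xi)).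
  - intros xi; split; [apply Rabs_le_between|intros H; now apply Rabs_le_between].
  - apply decidable_and; apply decidable_Rle; try assumption; now apply computableR_opp.
Qed.

Ltac comp := lazymatch goal with
  | |- Decidable _ _ (fun xi => @?P xi /\ @?Q xi) => apply (decidable_and _ _ P Q); cbv beta; comp
  | |- Decidable _ _ (fun xi => @?P xi \/ @?Q xi) => apply (decidable_or _ _ P Q); cbv beta; comp
  | |- Decidable _ _ (fun xi => ~ @?P xi) => apply (decidable_not _ _ P); cbv beta; comp
  | |- Decidable _ _ (fun xi => exists n : nat, @?P xi n) => apply (decidable_ex _ _ P); cbv beta; comp
  | |- Decidable _ _ (fun xi => forall n : nat, @?P xi n) => apply (decidable_all _ _ P); cbv beta; comp
  | |- Decidable _ _ (fun xi => @?P xi -> @?Q xi) => apply (decidable_imp _ _ P Q); cbv beta; comp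
  | |- Decidable _ _ (fun xi => Rabs (@?v xi) <= @?w xi) => apply (decidable_Rabs_le _ _ v w); cbv beta; comp
  | |- Decidable _ _ (fun xi => @?v xi <= @?w xi) => apply (decidable_Rle _ _ v w); cbv beta; comp
  | |- Decidable _ _ (fun xi => @?v xi < @?w xi) => apply (decidable_Rlt _ _ v w); cbv beta; comp
  | |- Decidable _ _ (fun xi => @eq nat (@?v xi) (@?w xi)) => apply (decidable_eq _ _ v w); cbv beta; comp
  | |- Decidable _ _ (fun _ => ?P) => exact (decidable_const _ _ P)
  | |- Decidable _ _ _ => try (first [assumption | eassumption | eapply decidable_weaken; cycle 1;
      [intros ? ?; cbn [fst snd]; reflexivity|comp]])
  | |- ComputableR _ _ (fun _ => 0) => apply computableR_0
  | |- ComputableR _ _ (fun _ => 1) => apply computableR_1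
  | |- ComputableR _ _ (fun xi => rat (@?f xi)) => apply (computableR_rat _ _ f); cbv beta; comp
  | |- ComputableR _ _ (fun xi => / 2 ^ (@?f xi)) => apply (computableR_half_power _ _ f); cbv beta; comp
  | |- ComputableR _ _ (fun xi => @?v xi + @?w xi) => apply (computableR_plus _ _ v w); cbv beta; comp
  | |- ComputableR _ _ (fun xi => @?v xi - @?w xi) => apply (computableR_minus _ _ v w); cbv beta; comp
  | |- Computable _ _ (fun xi => S (@?f xi)) => apply (computable_S _ _ f); cbv beta; comp
  | |- Computable _ _ (fun xi => fst (Cantor.of_nat (@?f xi))) => apply (computable_fst _ _ f); cbv beta; comp
  | |- Computable _ _ (fun xi => snd (Cantor.of_nat (@?f xi))) => apply (computable_snd _ _ f); cbv beta; comp
  | |- Computable _ _ (fun xi => half_power (@?f xi)) => apply (computable_half_power _ _ f); cbv beta; comp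
  | |- Computable _ _ (fun _ => ?n) => exact (computable_const _ _ n)
  | |- Computable _ (Nat :: _) (fun xi => fst xi) => apply computable_var0
  | |- Computable _ (Nat :: _) (@fst _ _) => apply computable_var0
  | |- Computable _ _ _ => try (first [assumption | weaken; comp])
  | |- _ => idtac
  end.

(** * No Cantor realiser is computable from objects of type two *)

(** Symbolic arguments: a number, a consultable object of type two known by its name, or a
computation waiting for arguments that will be put in front of its list [ctx]. *)
Inductive closure : Type :=
| Num : nat -> closure
| Orc : nat -> closure
| Clo : nat -> list closure -> closure.

Inductive task : Type :=
| Eval : nat -> list closure -> task
| App : closure -> list closure -> task.

(** Lazy evaluation of S1-S9.  Where S8 asks for total inner functions, here the inner functions are
merely suspended; totality is asked only of the argument of an oracle.  Arguments of type 0 are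
suspended as well, hence the premises that evaluate a closure without arguments.  The indices are
given by equations, because [code] is not a constructor and inversion would unfold it. *)
Inductive run (O : nat -> (nat -> nat) -> nat -> Prop) : task -> nat -> Prop :=
| run_num n : run O (App (Num n) []) n
| run_orc i c f y :
    (forall n, run O (App c [Num n]) (f n)) -> O i f y -> run O (App (Orc i) [c]) y
| run_clo e ctx cs y :
    run O (Eval e (cs ++ ctx)) y -> run O (App (Clo e ctx) cs) y
| run_succ e c ctx x :
    e = code [1%nat] ->
    run O (App c []) x -> run O (Eval e (c :: ctx)) (S x)
| run_const e q ctx :
    e = code [2%nat; q] -> run O (Eval e ctx) q
| run_proj e c ctx x :
    e = code [3%nat] ->
    run O (App c []) x -> run O (Eval e (c :: ctx)) x
| run_comp e e1 e2 ctx y z :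
    e = code [4%nat; e1; e2] ->
    run O (Eval e2 ctx) y -> run O (Eval e1 (Num y :: ctx)) z ->
    run O (Eval e ctx) z
| run_rec0 e e1 e2 c ctx y :
    e = code [5%nat; e1; e2] ->
    run O (App c []) 0%nat -> run O (Eval e1 ctx) y ->
    run O (Eval e (c :: ctx)) y
| run_recS e e1 e2 c ctx x y z :
    e = code [5%nat; e1; e2] ->
    run O (App c []) (S x) ->
    run O (Eval e (Num x :: ctx)) y ->
    run O (Eval e2 (Num x :: Num y :: ctx)) z ->
    run O (Eval e (c :: ctx)) z
| run_perm e e1 p ctx y :
    e = code (6%nat :: e1 :: p) ->
    run O (Eval e1 (map (fun i => nth i ctx (Num 0)) p)) y ->
    run O (Eval e ctx) y
| run_app1 e c c' ctx y :
    e = code [7%nat] ->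
    run O (App c [c']) y -> run O (Eval e (c :: c' :: ctx)) y
| run_app e c es ctx y :
    e = code (8%nat :: es) ->
    run O (App c (map (fun e => Clo e (c :: ctx)) es)) y ->
    run O (Eval e (c :: ctx)) y
| run_refl e n c d ctx y :
    e = code [9%nat; n] ->
    run O (App c []) d -> run O (Eval d (firstn n ctx)) y ->
    run O (Eval e (c :: ctx)) y.

Lemma code_inj l l' : code l = code l' -> l = l'.
Proof.
  revert l'; induction l as [|a l IH]; intros [|a' l'] H; try discriminate H.
  - reflexivity.
  - change (S (Cantor.to_nat (a, code l)) = S (Cantor.to_nat (a', code l'))) in H.
    apply Nat.succ_inj in H.
    apply (f_equal Cantor.of_nat) in H; rewrite !Cantor.cancel_of_to in H.
    injection H as -> H; f_equal; auto.
Qed.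

Lemma run_mono (O O' : nat -> (nat -> nat) -> nat -> Prop) t y :
  (forall i f z, O i f z -> O' i f z) -> run O t y -> run O' t y.
Proof.
  intros HO H; induction H; try (econstructor; eauto; fail).
Qed.

(** Determinacy makes the code of a closure that computes a real an injective name of that real. *)
Lemma run_det (O : nat -> (nat -> nat) -> nat -> Prop) t y y' :
  (forall i f z z', O i f z -> O i f z' -> z = z') ->
  run O t y -> run O t y' -> y = y'.
Proof.
  intros HO H; revert y'; induction H; intros y' H'; inversion H'; clear H'; subst;
    repeat match goal with
    | E : code _ = code _ |- _ =>
        apply code_inj in E;
        first [discriminate E | injection E as; subst | clear E]
    end;
    repeat match goal with
    | IH : forall z, run O ?t z -> _ = z, E : run O ?t _ |- _ =>
        apply IH in E; clear IH;
        first [discriminate E | injection E as; subst | subst]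
    end; try congruence.
  (* two evaluations of the argument of an oracle agree as functions *)
  assert (f = f0) as <- by (apply functional_extensionality; auto).
  eauto.
Qed.

(** The logical relation between the behaviour of a closure and a functional: related arguments are
sent to related values.  A closure need not behave well on other arguments, and a functional may
have arguments that no closure is related to. *)
Fixpoint rel O (s : ty) : (list closure -> nat -> Prop) -> interp s -> Prop :=
  match s with
  | Nat => fun P n => P [] n
  | Arr s t => fun P g =>
      forall c x, rel O s (fun cs => run O (App c cs)) x ->
        rel O t (fun cs => P (c :: cs)) (g x)
  end.

Definition realises O (c : closure) (o : obj) : Prop :=
  rel O (otype o) (fun cs => run O (App c cs)) (oval o).

Lemma rel_apply O s P (g : interp s) :
  rel O s P g <->
  forall (G : env (args s)) cs, Forall2 (realises O) cs (objs G) -> P cs (apply s g G).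
Proof.
  revert P g; induction s as [|s IHs t IHt]; intros P g; cbn.
  - split.
    + intros H G cs HG; inversion HG; subst; exact H.
    + intros H; exact (H tt [] (Forall2_nil _)).
  - split.
    + intros H [x G] cs HG; cbn in *; inversion HG as [|c o cs' os Hc Hcs]; subst.
      exact (proj1 (IHt _ _) (H c x Hc) G cs' Hcs).
    + intros H c x Hc; apply IHt; intros G cs HG.
      apply (H (x, G)); constructor; assumption.
Qed.

Lemma Forall2_nth_error A B (R : A -> B -> Prop) l l' :
  length l = length l' ->
  (forall j a b, nth_error l j = Some a -> nth_error l' j = Some b -> R a b) ->
  Forall2 R l l'.
Proof.
  revert l'; induction l as [|a l IH]; intros [|b l'] Hl H; try discriminate; constructor.
  - exact (H 0%nat a b eq_refl eq_refl).
  - apply IH; [now injection Hl|]. intros j; exact (H (S j)).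
Qed.

(** The index is the same on both sides, so no translation of indices has to be made computable.
The premises of S8 concern all inner arguments, and the logical relation asks for those that are
realised by closures. *)
Lemma adequacy O e Phi y ctx :
  Kleene e Phi y -> Forall2 (realises O) ctx Phi -> run O (Eval e ctx) y.
Proof.
  intros H; revert ctx; induction H; intros ctx Hctx.
  - inversion Hctx; subst; eapply run_succ; eauto.
  - eapply run_const; eauto.
  - inversion Hctx; subst; eapply run_proj; eauto.
  - eapply run_comp; eauto. apply IHKleene2; constructor; [exact (run_num O y)|assumption].
  - inversion Hctx; subst; eapply run_rec0; eauto.
  - inversion Hctx as [|c o cs os Hc Hcs]; subst; eapply run_recS;
      [reflexivity|exact Hc| |].
    + apply IHKleene1; constructor; [exact (run_num O x)|assumption].
    + apply IHKleene2; constructor; [exact (run_num O x)|].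
      constructor; [exact (run_num O y)|assumption].
  - eapply run_perm; eauto. apply IHKleene.
    assert (Hlt : forall i, In i p -> (i < length Phi)%nat).
    { intros i Hi; apply (Permutation_in _ H), in_seq in Hi; lia. }
    clear - Hctx Hlt. induction p as [|i p IH]; cbn; constructor.
    + assert (Hi : (i < length Phi)%nat) by (apply Hlt; now left). clear - Hctx Hi.
      revert i Hi; induction Hctx; intros i Hi; cbn in *; [lia|].
      destruct i as [|i]; [assumption|]. apply IHHctx; lia.
    + apply IH; intros i' Hi'; apply Hlt; now right.
  - inversion Hctx as [|c o cs os Hc Hcs]; subst; inversion Hcs; subst.
    eapply run_app1; eauto. apply Hc. assumption.
  - inversion Hctx as [|c o cs os Hc Hcs]; subst.
    eapply run_app; eauto. apply (proj1 (rel_apply _ _ _ _) Hc).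
    apply Forall2_nth_error; [now rewrite length_map, objs_length|].
    intros j c' [t g] Hj Hg; rewrite nth_error_map in Hj.
    destruct (nth_error es j) as [e|] eqn:He; [|discriminate]; injection Hj as <-.
    apply rel_apply; intros xi cs' Hxi; apply run_clo, (H1 j e t g He Hg xi).
    apply Forall2_app; assumption.
  - inversion Hctx as [|c o cs os Hc Hcs]; subst.
    apply Forall2_app_inv_r in Hcs as (l1 & l2 & H1 & H2 & ->).
    eapply run_refl; [reflexivity|exact Hc|]. apply IHKleene.
    rewrite <- (Forall2_length H1), firstn_app, firstn_all, Nat.sub_diag, app_nil_r; assumption.
Qed.

Fixpoint encode (c : closure) : nat :=
  match c with
  | Num n => code [0%nat; n]
  | Orc i => code [1%nat; i]
  | Clo e ctx => code (2%nat :: e :: map encode ctx)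
  end.

Fixpoint encode_inj (c c' : closure) {struct c} : encode c = encode c' -> c = c'.
Proof.
  destruct c as [n|i|e ctx], c' as [n'|i'|e' ctx']; cbn [encode]; intros H;
    apply code_inj in H; try discriminate H; injection H as H; try congruence.
  subst e'; f_equal. revert ctx' H0; induction ctx as [|c ctx IH]; intros [|c' ctx'] H;
    try discriminate H; [reflexivity|].
  injection H as Hc Hctx. f_equal; [exact (encode_inj c c' Hc)|exact (IH ctx' Hctx)].
Qed.

Lemma rep_unique f r r' : rep RealS f r -> rep RealS f r' -> r = r'.
Proof.
  intros [_ H] [_ H']. apply is_lim_seq_unique in H; apply is_lim_seq_unique in H'.
  congruence.
Qed.

(** Z, E2, the set A and the injection Y, with the graph [D] of a partial function from the reals to
the natural numbers in the role of Y.  At a function that represents a real outside the domain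
of [D], Y has no value; A has none either if the real is in [0,1], so that A never answers that
such a real is absent, and the oracles only grow with [D]. *)
Definition partial_oracle (Z : interp ty2) (D : R * nat -> Prop) (i : nat)
    (f : nat -> nat) (z : nat) : Prop :=
  match i with
  | 0%nat => z = Z f
  | 1%nat => z = E2 f
  | 2%nat => (exists r, rep RealS f r /\
                 ((~ I01 r /\ z = 0%nat) \/ (I01 r /\ (exists n, D (r, n)) /\ z = 1%nat)))
             \/ ((forall r, ~ rep RealS f r) /\ z = 0%nat)
  | _ => (exists r, rep RealS f r /\ D (r, z))
         \/ ((forall r, ~ rep RealS f r) /\ z = 0%nat)
  end.

Definition self_indexed (Z : interp ty2) (D : R * nat -> Prop) : Prop :=
  (forall r n n', D (r, n) -> D (r, n') -> n = n') /\
  (forall r n, D (r, n) -> exists c f, encode c = n /\ rep RealS f r /\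
     forall m, run (partial_oracle Z D) (App c [Num m]) (f m)).

Lemma partial_oracle_mono Z D D' i f z :
  (forall p, D p -> D' p) -> partial_oracle Z D i f z -> partial_oracle Z D' i f z.
Proof.
  intros HD; destruct i as [|[|[|i]]]; cbn; firstorder.
Qed.

Lemma partial_oracle_fun Z D i f z z' :
  (forall r n n', D (r, n) -> D (r, n') -> n = n') ->
  partial_oracle Z D i f z -> partial_oracle Z D i f z' -> z = z'.
Proof.
  intros HD; destruct i as [|[|[|i]]]; cbn; try congruence.
  - intros [(r & Hr & H)|[H ->]] [(r' & Hr' & H')|[H' ->]]; try easy;
      try (exfalso; eapply H; eassumption); try (exfalso; eapply H'; eassumption).
    rewrite (rep_unique f r' r Hr' Hr) in *. intuition congruence.
  - intros [(r & Hr & H)|[H ->]] [(r' & Hr' & H')|[H' ->]]; try easy;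
      try (exfalso; eapply H; eassumption); try (exfalso; eapply H'; eassumption).
    rewrite (rep_unique f r' r Hr' Hr) in *. eauto.
Qed.

(** A real that is computed but not in the domain could be added, with the code of the closure that
computes it: by monotonicity, closures go on computing what they computed before. *)
Lemma self_indexed_maximal Z :
  exists D, self_indexed Z D /\
    forall c f r, rep RealS f r ->
      (forall m, run (partial_oracle Z D) (App c [Num m]) (f m)) -> exists n, D (r, n).
Proof.
  destruct (@classical_sets.Zorn_bigcup (R * nat) (self_indexed Z)) as (D & HD & Hmax).
  - intros F HF Htot; split.
    + intros r n n' [X HX H] [X' HX' H'].
      destruct (Htot X X' HX HX') as [Hs|Hs].
      * exact (proj1 (HF X' HX') r n n' (Hs _ H) H').
      * exact (proj1 (HF X HX) r n n' H (Hs _ H')).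
    + intros r n [X HX H].
      destruct (proj2 (HF X HX) r n H) as (c & f & Hc & Hf & Hrun).
      exists c, f; repeat split; try apply Hf; try assumption. intros m; eapply run_mono; [|apply Hrun].
      intros i g z; apply partial_oracle_mono; intros p Hp; exists X; assumption.
  - exists D; split; [exact HD|]. intros c f r Hf Hrun.
    destruct (classic (exists n, D (r, n))) as [|Hno]; [assumption|exfalso].
    apply (Hmax (fun p => D p \/ p = (r, encode c))).
    + split; [now left|]. intros Hsub; apply Hno; exists (encode c); apply Hsub; now right.
    + split.
      * intros s n n' [H|H] [H'|H'].
        -- exact (proj1 HD s n n' H H').
        -- assert (s = r) as -> by congruence. exfalso; eauto.
        -- assert (s = r) as -> by congruence. exfalso; eauto.
        -- congruence.
      * intros s n H.
        assert (E : exists c f, encode c = n /\ rep RealS f s /\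
                    forall m, run (partial_oracle Z D) (App c [Num m]) (f m)).
        { destruct H as [H|H]; [exact (proj2 HD s n H)|injection H as -> ->; eauto]. }
        destruct E as (c' & f' & Hc' & Hf' & Hrun'). exists c', f'; repeat split; try apply Hf'; try assumption.
        intros m; eapply run_mono; [|apply Hrun'].
        intros i g z; apply partial_oracle_mono; now left.
Qed.

Lemma rep_zero : rep RealS (fun _ => 0%nat) 0.
Proof.
  assert (E : rat 0 = 0) by (unfold rat; cbn; lra).
  split.
  - intros n i; rewrite E, Rminus_0_r, Rabs_R0. apply Rinv_0_lt_compat, pow_lt; lra.
  - rewrite E. apply is_lim_seq_const.
Qed.

Lemma oracle_realises Z D i (F : interp ty2) :
  (forall c f, (forall m, run (partial_oracle Z D) (App c [Num m]) (f m)) ->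
     partial_oracle Z D i f (F f)) ->
  realises (partial_oracle Z D) (Orc i) (Obj ty2 F).
Proof.
  intros HF c f Hc; cbn in Hc. cbn.
  assert (Hrun : forall m, run (partial_oracle Z D) (App c [Num m]) (f m)).
  { intros m; apply Hc; apply run_num. }
  eapply run_orc; [exact Hrun|eauto].
Qed.

(** The sets A and Y are total here; A answers 0 at reals of [0,1] outside the domain of [D], where
the partial oracle is silent, but no closure computes such a real. *)
Theorem cantor_realiser_not_computable (Z : interp ty2) s (Phi : interp s) (C : interp cantor_ty) :
  computable_in [Obj ty2 Z] s Phi ->
  computable_in [Obj s Phi; Obj ty2 E2] cantor_ty C ->
  ~ cantor_realiser C.
Proof.
  intros [d Hd]%computable_in_swap [e He]%computable_in_swap HC.
  destruct (self_indexed_maximal Z) as (D & [Dfun Dind] & Dmax).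
  set (O := partial_oracle Z D) in *.
  set (a := fun r => if excluded_middle_informative (I01 r /\ exists n, D (r, n)) then true else false).
  set (y := fun r => epsilon (inhabits 0%nat) (fun n => D (r, n))).
  assert (Ha : forall r, a r = true <-> I01 r /\ exists n, D (r, n)).
  { intros r; unfold a; destruct excluded_middle_informative; intuition congruence. }
  assert (Hy : forall r n, D (r, n) -> y r = n).
  { intros r n H; apply (Dfun r); [|exact H].
    apply (epsilon_spec (inhabits 0%nat) (fun n => D (r, n))); eauto. }
  set (val := fun f => epsilon (inhabits 0) (rep RealS f)).
  assert (Hval : forall f r, rep RealS f r -> val f = r).
  { intros f r H; apply (rep_unique f); [|exact H].
    apply (epsilon_spec (inhabits 0) (rep RealS f)); eauto. }
  set (A := (fun f => if excluded_middle_informative (exists r, rep RealS f r)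
                      then Nat.b2n (a (val f)) else 0%nat) : interp ty2).
  set (Y := (fun f => if excluded_middle_informative (exists r, rep RealS f r)
                      then y (val f) else 0%nat) : interp ty2).
  assert (HA : rep (FunS RealS BoolS) A a).
  { intros f r Hf; cbn; unfold A; destruct excluded_middle_informative as [_|H];
      [now rewrite (Hval f r Hf)|exfalso; eauto]. }
  assert (HY : rep (FunS RealS NatS) Y y).
  { intros f r Hf; cbn; unfold Y; destruct excluded_middle_informative as [_|H];
      [now rewrite (Hval f r Hf)|exfalso; eauto]. }
  assert (RZ : realises O (Orc 0) (Obj ty2 Z)) by (apply oracle_realises; reflexivity).
  assert (RE : realises O (Orc 1) (Obj ty2 E2)) by (apply oracle_realises; reflexivity).
  assert (RA : realises O (Orc 2) (Obj ty2 A)).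
  { apply oracle_realises; intros c f Hf; cbn; unfold A.
    destruct excluded_middle_informative as [[r Hr]|Hno];
      [left|right; split; [|reflexivity]; intros r Hr; exact (Hno (ex_intro _ r Hr))].
    (* the real is computed by [c], hence in the domain *)
    rewrite (Hval f r Hr). exists r; split; [exact Hr|].
    destruct (Dmax c f r Hr Hf) as [n Hn].
    destruct (classic (I01 r)) as [H01|H01].
    - right; split; [exact H01|split; [now exists n|]]. now rewrite (proj2 (Ha r)) by eauto.
    - left; split; [exact H01|]. destruct (a r) eqn:E; [|reflexivity].
      exfalso; apply H01, Ha, E. }
  assert (RY : realises O (Orc 3) (Obj ty2 Y)).
  { apply oracle_realises; intros c f Hf; cbn; unfold Y.
    destruct excluded_middle_informative as [[r Hr]|Hno];
      [left|right; split; [|reflexivity]; intros r Hr; exact (Hno (ex_intro _ r Hr))].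
    rewrite (Hval f r Hr). exists r; split; [exact Hr|].
    destruct (Dmax c f r Hr Hf) as [n Hn]. now rewrite (Hy r n Hn). }
  assert (RPhi : realises O (Clo d [Orc 0]) (Obj s Phi)).
  { apply rel_apply; intros G cs HG; cbn; apply run_clo.
    apply (adequacy _ _ _ _ _ (Hd G)), Forall2_app; auto. }
  destruct (HC A Y a y HA HY) as (r & Hr & Hpost).
  assert (Hrun : exists n, D (r, n)).
  (* so the point that [C] produces is in the domain as well *)
  { destruct (kleene_select 5 [1; 2; 0; 3; 4]%nat e) as [e' He'].
    { repeat constructor; cbn; lia. }
    { cbn; lia. }
    apply (Dmax (Clo e' [Orc 2; Orc 3; Clo d [Orc 0]; Orc 1]) _ r Hr).
    intros m; apply run_clo.
    apply (adequacy _ _ [Obj Nat m; Obj ty2 A; Obj ty2 Y; Obj s Phi; Obj ty2 E2]).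
    - apply He'; [reflexivity|exact (He (A, (Y, (m, tt))))].
    - repeat (constructor; [assumption || apply run_num|]); constructor. }
  destruct Hpost as [H01 Hno].
  - exists 0; apply Ha; split; [unfold I01; lra|].
    apply (Dmax (Clo (code [2%nat; 0%nat]) []) _ 0 rep_zero).
    intros m; apply run_clo; eapply run_const; reflexivity.
  - intros x Hx; apply Ha in Hx; tauto.
  - intros x x' Hx Hx' E; apply Ha in Hx as [_ [n Hn]]; apply Ha in Hx' as [_ [n' Hn']].
    rewrite (Hy _ _ Hn), (Hy _ _ Hn') in E; subst n'.
    destruct (Dind x n Hn) as (c & f & Hc & Hf & Hrc).
    destruct (Dind x' n Hn') as (c' & f' & Hc' & Hf' & Hrc').
    assert (c = c') as <- by (apply encode_inj; congruence).
    assert (f = f') as <-.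
    { apply functional_extensionality; intros m; eapply run_det; [|apply Hrc|apply Hrc'].
      intros i g z z'; apply partial_oracle_fun, Dfun. }
    exact (rep_unique f x x' Hf Hf').
  - assert (a r = true) by (apply Ha; tauto). congruence.
Qed.

(** * The function with spikes at the points of a countable set *)

Definition spike (a : R -> bool) (y : R -> nat) (r : R) : R :=
  if a r then / 2 ^ S (y r) else 0.

Definition injective_on (a : R -> bool) (y : R -> nat) : Prop :=
  forall x x', a x = true -> a x' = true -> y x = y x' -> x = x'.

Lemma half_pow_pos n : 0 < / 2 ^ n.
Proof. apply Rinv_0_lt_compat, pow_lt; lra. Qed.

Lemma half_pow_S n : / 2 ^ S n = / 2 ^ n / 2.
Proof. cbn; rewrite Rinv_mult; lra. Qed.

Lemma half_pow_le m n : (m <= n)%nat -> / 2 ^ n <= / 2 ^ m.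
Proof.
  intros H; apply Rinv_le_contravar; [apply pow_lt; lra|apply Rle_pow; [lra|exact H]].
Qed.

Lemma half_pow_small eps : 0 < eps -> exists n, / 2 ^ n < eps.
Proof.
  intros H; destruct (pow_lt_1_zero (/ 2)) with (y := eps) as [n Hn];
    [rewrite Rabs_pos_eq; lra|exact H|].
  exists n; rewrite <- pow_inv; eapply Rle_lt_trans; [apply Rle_abs|apply Hn; lia].
Qed.

Lemma spike_bounds a y r : 0 <= spike a y r <= / 2.
Proof.
  unfold spike; destruct (a r); [|lra]. pose proof (half_pow_pos (S (y r))).
  pose proof (half_pow_le 1 (S (y r)) ltac:(lia)) as H'; rewrite pow_1 in H'; lra.
Qed.

Lemma spike_zero a y r : spike a y r = 0 <-> a r = false.
Proof.
  unfold spike; destruct (a r); [|easy]. pose proof (half_pow_pos (S (y r))).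
  split; [lra|discriminate].
Qed.

(** At most n of the spikes are at least 2^-n. *)
Lemma spike_small a y x eps : injective_on a y -> 0 < eps ->
  exists delta, 0 < delta /\
    forall z, z <> x -> Rabs (z - x) < delta -> spike a y z < eps.
Proof.
  intros Hinj Heps; destruct (half_pow_small eps Heps) as [n Hn].
  enough (exists delta, 0 < delta /\
    forall z, z <> x -> Rabs (z - x) < delta -> a z = true -> (n <= y z)%nat)
    as (delta & Hd & H).
  { exists delta; split; [exact Hd|]; intros z Hz Hzx; unfold spike.
    destruct (a z) eqn:E; [|exact Heps].
    pose proof (half_pow_le n (S (y z))) as Hle.
    specialize (H z Hz Hzx E). assert (n <= S (y z))%nat by lia. intuition lra. }
  clear eps Heps Hn; induction n as [|n (delta & Hd & H)].
  - exists 1; split; [lra|intros; lia].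
  - destruct (classic (exists p, p <> x /\ a p = true /\ y p = n)) as [(p & Hp & Hap & Hyp)|Hno].
    + exists (Rmin delta (Rabs (p - x))); split.
      * apply Rmin_pos; [exact Hd|apply Rabs_pos_lt; lra].
      * intros z Hz Hzx Haz. pose proof (Rmin_l delta (Rabs (p - x))).
        pose proof (Rmin_r delta (Rabs (p - x))).
        specialize (H z Hz ltac:(lra) Haz).
        enough (y z <> n) by lia. intros E.
        assert (z = p) as -> by (apply Hinj; congruence). lra.
    + exists delta; split; [exact Hd|]; intros z Hz Hzx Haz.
      specialize (H z Hz Hzx Haz). enough (y z <> n) by lia. intros E; apply Hno; now exists z.
Qed.

Lemma I01_subinterval x delta : I01 x -> 0 < delta ->
  exists p q, 0 <= p /\ p < q /\ q <= 1 /\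
    forall z, p <= z <= q -> z <> x /\ Rabs (z - x) < delta.
Proof.
  intros Hx Hd; unfold I01 in Hx; set (d := Rmin (delta / 2) (1 / 4)).
  assert (0 < d <= 1 / 4 /\ d < delta).
  { unfold d; pose proof (Rmin_l (delta / 2) (1 / 4)); pose proof (Rmin_r (delta / 2) (1 / 4)).
    pose proof (Rmin_pos (delta / 2) (1 / 4)); lra. }
  destruct (Rle_dec x (1 / 2)).
  - exists (x + d / 2), (x + d); repeat split; try lra. apply Rabs_def1; lra.
  - exists (x - d), (x - d / 2); repeat split; try lra. apply Rabs_def1; lra.
Qed.

(** Values as small as desired occur near any point; this replaces the density of the zeros, which
would need the uncountability of the reals. *)
Lemma spike_near a y x delta eps : injective_on a y -> I01 x -> 0 < delta -> 0 < eps ->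
  exists z, I01 z /\ z <> x /\ Rabs (z - x) < delta /\ spike a y z < eps.
Proof.
  intros Hinj Hx Hd He.
  destruct (spike_small a y x eps Hinj He) as (delta' & Hd' & H).
  destruct (I01_subinterval x (Rmin delta delta') Hx (Rmin_pos _ _ Hd Hd')) as (p & q & Hp & Hpq & Hq & Hz).
  destruct (Hz p ltac:(lra)) as [Hpx Habs].
  pose proof (Rmin_l delta delta'); pose proof (Rmin_r delta delta').
  exists p; repeat split; try lra. apply H; lra.
Qed.

Lemma spike_subinterval a y p q eps : injective_on a y -> p < q -> 0 < eps ->
  exists p' q', p < p' /\ p' < q' /\ q' < q /\ forall z, p' <= z <= q' -> spike a y z < eps.
Proof.
  intros Hinj Hpq He.
  destruct (spike_small a y ((p + q) / 2) eps Hinj He) as (delta & Hd & H).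
  set (d := Rmin (delta / 2) ((q - p) / 4)).
  assert (0 < d <= (q - p) / 4 /\ d < delta).
  { unfold d; pose proof (Rmin_l (delta / 2) ((q - p) / 4)); pose proof (Rmin_r (delta / 2) ((q - p) / 4)).
    pose proof (Rmin_pos (delta / 2) ((q - p) / 4)); lra. }
  exists ((p + q) / 2 + d / 2), ((p + q) / 2 + d); repeat split; try lra.
  intros z Hz; apply H; [lra|]. apply Rabs_def1; lra.
Qed.

Lemma nested_intervals (p q : nat -> R) :
  (forall n, p n < p (S n) /\ p (S n) < q (S n) /\ q (S n) < q n) ->
  exists x, forall n, p n < x < q n.
Proof.
  intros H.
  assert (Hp : forall n m, (n <= m)%nat -> p n <= p m).
  { intros n m Hnm; induction Hnm; [lra|]. specialize (H m); lra. }
  assert (Hq : forall n m, (n <= m)%nat -> q m <= q n).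
  { intros n m Hnm; induction Hnm; [lra|]. specialize (H m); lra. }
  assert (Hpq : forall n m, p n <= q m).
  { intros n m; pose proof (Hp n (S (max n m)) ltac:(lia)); pose proof (Hq m (S (max n m)) ltac:(lia)).
    specialize (H (max n m)); lra. }
  destruct (completeness (fun r => exists n, r = p n)) as [x [Hub Hlub]].
  - exists (q 0%nat); intros r [n ->]; apply Hpq.
  - now exists (p 0%nat), 0%nat.
  - exists x; intros n; destruct (H n) as (H1 & H2 & H3); split.
    + apply Rlt_le_trans with (p (S n)); [exact H1|apply Hub; eauto].
    + apply Rle_lt_trans with (q (S n)); [|exact H3]. apply Hlub; intros r [m ->]; apply Hpq.
Qed.

Lemma spike_cont_pts a y x : injective_on a y ->
  cont_pts (spike a y) x <-> I01 x /\ a x = false.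
Proof.
  intros Hinj; split; intros [Hx H]; (split; [exact Hx|]).
  - apply (spike_zero a y). destruct (spike_bounds a y x) as [[Hpos|Hz] _]; [exfalso|now symmetry].
    destruct (H (spike a y x / 2) ltac:(lra)) as (delta & Hd & Hc).
    destruct (spike_near a y x delta (spike a y x / 2) Hinj Hx Hd ltac:(lra))
      as (z & Hz & Hzx & Hzd & Hs).
    specialize (Hc z (conj (conj Hz (not_eq_sym Hzx)) Hzd)).
    cbn in Hc; unfold R_dist in Hc; apply Rabs_def2 in Hc; lra.
  - intros eps He; destruct (spike_small a y x eps Hinj He) as (delta & Hd & Hs).
    exists delta; split; [exact Hd|]; intros z [[_ Hzx] Hzd].
    apply (spike_zero a y) in H. cbn; unfold R_dist; rewrite H, Rminus_0_r.
    rewrite Rabs_pos_eq by apply spike_bounds. apply Hs; [auto|exact Hzd].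
Qed.

Lemma open_in_I_interval p q : 0 <= p -> q <= 1 -> open_in_I (fun z => p < z < q).
Proof.
  intros Hp Hq; exists (fun z => p < z < q); split.
  - apply open_and; [apply open_gt|apply open_lt].
  - intros z; unfold I01; split; lra.
Qed.

Lemma open_in_I_ball U x : open_in_I U -> U x ->
  exists delta, 0 < delta /\ forall z, I01 z -> Rabs (z - x) < delta -> U z.
Proof.
  intros (V & HV & HU) Hx; destruct (HV x (proj2 (proj1 (HU x) Hx))) as [delta Hd].
  exists delta; split; [apply cond_pos|]. intros z Hz Hzx; apply HU; split; [exact Hz|].
  apply Hd, Hzx.
Qed.

Lemma spike_cliquish01 a y : injective_on a y -> cliquish01 (spike a y).
Proof.
  intros Hinj; split.
  - intros x _; pose proof (spike_bounds a y x); unfold I01; lra.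
  - intros x eps U Hx He HU HUx.
    destruct (open_in_I_ball U x HU HUx) as (delta & Hd & Hball).
    destruct (I01_subinterval x delta Hx Hd) as (p & q & Hp & Hpq & Hq & Hz).
    destruct (spike_subinterval a y p q eps Hinj Hpq He) as (p' & q' & H1 & H2 & H3 & Hs).
    exists (fun z => p' < z < q'); split; [|split; [|split]].
    + apply open_in_I_interval; lra.
    + exists ((p' + q') / 2); lra.
    + intros z Hz'; apply Hball; [unfold I01; lra|apply Hz; lra].
    + intros u v Hu Hv; pose proof (spike_bounds a y u); pose proof (spike_bounds a y v).
      pose proof (Hs u ltac:(lra)); pose proof (Hs v ltac:(lra)). apply Rabs_def1; lra.
Qed.

Lemma is_RInt_zero (g : R -> R) u v : u <= v ->
  (forall z, u < z < v -> g z = 0) -> is_RInt g u v 0.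
Proof.
  intros Huv Hg; apply (is_RInt_ext (fun _ => 0)).
  - intros z; rewrite Rmin_left, Rmax_right by exact Huv; intros Hz; now rewrite Hg.
  - pose proof (is_RInt_const u v 0) as H; unfold scal in H; cbn in H; unfold mult in H; cbn in H.
    now rewrite Rmult_0_r in H.
Qed.

Lemma is_RInt_point (g : R -> R) p u v : u <= v ->
  (forall z, z <> p -> g z = 0) -> is_RInt g u v 0.
Proof.
  intros Huv Hg; destruct (classic (u < p < v)) as [Hp|Hp].
  - rewrite <- (Rplus_0_r 0); apply (is_RInt_Chasles g u p v); apply is_RInt_zero; try lra;
      intros z Hz; apply Hg; lra.
  - apply is_RInt_zero; [exact Huv|]; intros z Hz; apply Hg; intros ->; auto.
Qed.

(** The functions with the first n spikes only vanish outside finitely many points, and they converge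
uniformly to [spike]. *)
Lemma spike_is_RInt a y u v : injective_on a y -> u <= v -> is_RInt (spike a y) u v 0.
Proof.
  intros Hinj Huv.
  set (part := fun n r => if andb (a r) (y r <? n)%nat then / 2 ^ S (y r) else 0).
  assert (Hpart : forall n, is_RInt (part n) u v 0).
  { induction n as [|n IH].
    - apply is_RInt_zero; [exact Huv|]; intros z _; unfold part; now destruct (a z).
    - set (g := fun r => if andb (a r) (y r =? n)%nat then / 2 ^ S (y r) else 0).
      apply (is_RInt_ext (fun r => part n r + g r)).
      + intros z _; unfold part, g.
        destruct (a z); cbn [andb]; [|lra].
        destruct (Nat.ltb_spec (y z) n), (Nat.ltb_spec (y z) (S n)), (Nat.eqb_spec (y z) n);
          try lia; lra.
      + rewrite <- (Rplus_0_r 0); apply (is_RInt_plus (part n) g); [exact IH|].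
        destruct (classic (exists p, a p = true /\ y p = n)) as [(p & Hp & Hy)|Hno].
        * apply (is_RInt_point g p); [exact Huv|]; intros z Hz; unfold g.
          destruct (a z) eqn:E; cbn [andb]; [|reflexivity].
          destruct (Nat.eqb_spec (y z) n) as [E'|]; [|reflexivity].
          exfalso; apply Hz, Hinj; congruence.
        * apply is_RInt_zero; [exact Huv|]; intros z _; unfold g.
          destruct (a z) eqn:E; cbn [andb]; [|reflexivity].
          destruct (Nat.eqb_spec (y z) n) as [E'|]; [exfalso; eauto|reflexivity]. }
  destruct (filterlim_RInt part u v eventually _ (spike a y) (fun _ => 0) Hpart) as (If & HIf & H).
  - apply filterlim_locally; intros eps. destruct (half_pow_small eps (cond_pos eps)) as [N HN].
    exists N; intros n Hn r. change (Rabs (part n r - spike a y r) < eps).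
    unfold part, spike; destruct (a r); cbn [andb]; [|rewrite Rminus_0_r, Rabs_R0; apply cond_pos].
    destruct (Nat.ltb_spec (y r) n) as [Hlt|Hge].
    + rewrite Rminus_diag, Rabs_R0; apply cond_pos.
    + rewrite Rminus_0_l, Rabs_Ropp, Rabs_pos_eq by apply Rlt_le, half_pow_pos.
      apply Rle_lt_trans with (/ 2 ^ N); [apply half_pow_le; lia|exact HN].
  - assert (If = 0) as ->; [|exact H].
    apply (filterlim_locally_unique _ _ _ HIf), filterlim_const.
Qed.

(** On a small ball around x the infimum is 0 and the supremum exceeds neither the value at x nor
some small number by much. *)
Lemma spike_osc a y x : injective_on a y -> I01 x -> osc (spike a y) x = spike a y x.
Proof.
  intros Hinj Hx; unfold osc.
  rewrite (is_lim_seq_unique _ (spike a y x)); [reflexivity|].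
  apply is_lim_seq_spec; intros eps.
  destruct (spike_small a y x (eps / 2) Hinj (is_pos_div_2 eps)) as (delta & Hd & Hs).
  destruct (half_pow_small delta Hd) as [N HN].
  exists N; intros k Hk.
  set (D := fun z => I01 z /\ Rabs (z - x) < / 2 ^ k).
  assert (Hk' : / 2 ^ k <= / 2 ^ N) by now apply half_pow_le.
  assert (Hglb : Glb_Rbar (image (spike a y) D) = 0).
  { apply is_glb_Rbar_unique; split.
    - intros v (z & _ & ->); apply spike_bounds.
    - intros [b| |] Hb; [|destruct (Hb (spike a y x))|exact I].
      + apply Rnot_lt_le; intros Hpos.
        destruct (spike_near a y x (/ 2 ^ k) b Hinj Hx (half_pow_pos k) Hpos) as (z & Hz & _ & Hzx & Hsz).
        assert (b <= spike a y z) by (apply (Hb (spike a y z)); now exists z). lra.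
      + exists x; split; [split; [exact Hx|]|reflexivity].
        rewrite Rminus_diag, Rabs_R0; apply half_pow_pos. }
  destruct (Lub_Rbar_correct (image (spike a y) D)) as [Hub Hlub].
  assert (Hlow : Rbar_le (spike a y x) (Lub_Rbar (image (spike a y) D))).
  { apply Hub; exists x; split; [split; [exact Hx|]|reflexivity].
    rewrite Rminus_diag, Rabs_R0; apply half_pow_pos. }
  assert (Hup : Rbar_le (Lub_Rbar (image (spike a y) D)) (spike a y x + eps / 2)).
  { apply Hlub; intros v (z & [Hz Hzx] & ->); cbn.
    pose proof (spike_bounds a y x); pose proof (cond_pos eps).
    destruct (Req_dec z x) as [->|Hne]; [lra|]. specialize (Hs z Hne). lra. }
  unfold osc_on; fold D; rewrite Hglb.
  destruct (Lub_Rbar (image (spike a y) D)) as [l| |]; cbn in Hlow, Hup; try easy; cbn.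
  pose proof (cond_pos eps). apply Rabs_def1; lra.
Qed.

(** * Cantor realisers from solutions *)

(** The programs use a solution functional only through this, so that one program serves a
functional of the function alone and a functional of the function and its oscillation: in the
second case [H F] is the value at the pair of [F] with itself. *)
Definition HeadApplicable (o : obj) (X : rspace) (H : interp (rty RR) -> interp (rty X)) : Prop :=
  forall l F, ComputableF o l (rty RR) F -> Applicable o l (rty X) (fun xi => H (F xi)).

Definition solves_self_osc (X : rspace) (pre : (R -> R) -> Prop) (post : (R -> R) -> X -> Prop)
    (H : interp (rty RR) -> interp (rty X)) : Prop :=
  forall F f, rep RR F f -> exists v, rep X (H F) v /\
    (pre f -> (forall x, I01 x -> f x = osc f x) -> post f v).

Definition yields_realiser (X : rspace) (pre : (R -> R) -> Prop) (post : (R -> R) -> X -> Prop) : Prop :=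
  forall o H, HeadApplicable o X H -> solves_self_osc X pre post H ->
    exists C, cantor_realiser C /\ ComputableF o [] cantor_ty (fun _ => C).

Lemma computable_in_of_computableF s Phi C :
  ComputableF (Obj s Phi) [] cantor_ty (fun _ => C) ->
  computable_in [Obj s Phi; Obj ty2 E2] cantor_ty C.
Proof.
  intros [e He]; apply computable_in_swap; exists e; intros (A & Y & n & []).
  exact (He (A, (Y, (n, tt)))).
Qed.

Lemma not_computable_of_computes_cantor s P :
  computes_cantor_with_E2 s P -> not_computable_in_any_S2 s P.
Proof.
  intros HP k _ (Phi & HPhi & Hc); destruct (HP Phi HPhi) as (C & HC & HCc).
  exact (cantor_realiser_not_computable _ _ _ _ Hc HCc HC).
Qed.

Lemma hard_of_yields_realiser X pre post : yields_realiser X pre post -> hard X pre post.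
Proof.
  intros HX.
  assert (H1 : computes_cantor_with_E2 _ (solves X pre post)).
  { intros Phi HPhi.
    destruct (HX (Obj _ Phi) Phi) as (C & HC & Hcomp).
    - intros l F HF; apply (applicable_app _ _ (rty RR) (rty X) (fun _ => Phi) F); [|exact HF].
      apply applicable_var, argument_param.
    - intros F f HF; destruct (HPhi F f HF) as (v & Hv & Hpost); exists v; auto.
    - exists C; split; [exact HC|now apply computable_in_of_computableF]. }
  assert (H2 : computes_cantor_with_E2 _ (solves_osc X pre post)).
  { intros Phi HPhi.
    destruct (HX (Obj _ Phi) (fun F => Phi F F)) as (C & HC & Hcomp).
    - intros l F HF; apply (applicable_app _ _ (rty RR) (rty X) (fun xi => Phi (F xi)) F); [|exact HF].
      apply (applicable_app _ _ (rty RR) (Arr (rty RR) (rty X)) (fun _ => Phi) F); [|exact HF].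
      apply applicable_var, argument_param.
    - intros F f HF; destruct (HPhi F F f f HF HF) as (v & Hv & Hpost); exists v; auto.
    - exists C; split; [exact HC|now apply computable_in_of_computableF]. }
  split; [|split; [|split]]; auto using not_computable_of_computes_cantor.
Qed.

(** Constant sequences suffice, as every value of [spike] is rational; 0 is a code of 0. *)
Definition spike_rep (D : (nat -> nat) -> Prop) (Y : interp ty2) : interp (rty RR) :=
  fun x _ => if excluded_middle_informative (D x) then half_power (S (Y x)) else 0%nat.

Lemma rep_rat c : rep RealS (fun _ => c) (rat c).
Proof.
  split; [|apply is_lim_seq_const].
  intros n i; rewrite Rminus_diag, Rabs_R0; apply half_pow_pos.
Qed.

Lemma rep_spike D Y a y :
  rep (FunS RealS NatS) Y y -> (forall x r, rep RealS x r -> (D x <-> a r = true)) ->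
  rep RR (spike_rep D Y) (spike a y).
Proof.
  intros HY HD x r Hx; unfold spike_rep, spike; cbv beta.
  destruct excluded_middle_informative as [H|H].
  - rewrite (proj1 (HD x r Hx) H), <- (HY x r Hx), <- rat_half_power; apply rep_rat.
  - destruct (a r) eqn:E; [now apply (HD x r Hx) in E|].
    rewrite <- rat_0; apply rep_rat.
Qed.

Lemma computable_apply_var o l (A : env l -> interp ty2) (x : env l -> nat -> nat) :
  Argument o l ty2 A -> ComputableF o l (Arr Nat Nat) x -> Computable o l (fun xi => A xi (x xi)).
Proof.
  intros HA Hx; apply applicable_nat, (applicable_app o l (Arr Nat Nat) Nat A x);
    [now apply applicable_var|exact Hx].
Qed.

Lemma computable_apply_seq o l (x : env l -> nat -> nat) n :
  Argument o l (Arr Nat Nat) x -> Computable o l n -> Computable o l (fun xi => x xi (n xi)).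
Proof.
  intros HA Hx; apply applicable_nat, (applicable_app o l Nat Nat x n);
    [now apply applicable_var|exact Hx].
Qed.

Lemma computableF_var1 o l x : Argument o l (Arr Nat Nat) x -> ComputableF o l (Arr Nat Nat) x.
Proof.
  intros Hx; apply (computable_apply_seq o (Nat :: l) (fun p => x (snd p)) (fun p => fst p));
    [var|apply computable_var0].
Qed.

Lemma computableF_spike_rep o l (D : env l -> (nat -> nat) -> Prop) (Y : env l -> interp ty2) :
  Decidable o (Arr Nat Nat :: Nat :: l) (fun p => D (snd (snd p)) (fst p)) ->
  Argument o l ty2 Y ->
  ComputableF o l (rty RR) (fun xi => spike_rep (D xi) (Y xi)).
Proof.
  intros HD HY.
  apply (computable_if o (Arr Nat Nat :: Nat :: l) (fun p => D (snd (snd p)) (fst p))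
           (fun p => half_power (S (Y (snd (snd p)) (fst p)))) (fun _ => 0%nat) HD).
  - apply computable_half_power, computable_S.
    apply (computable_apply_var o (Arr Nat Nat :: Nat :: l) (fun p => Y (snd (snd p))) (fun p => fst p)).
    + var.
    + apply computableF_var1, argument_head.
  - apply computable_const.
Qed.

Definition lo (c : nat) : R := rat (fst (Cantor.of_nat c)).
Definition hi (c : nat) : R := rat (snd (Cantor.of_nat c)).

(** With denominator d above the inverse of q - p, the first multiple of 1/d after p is before q. *)
Lemma rat_dense p q : p < q -> exists c, p < rat c < q.
Proof.
  intros Hpq. destruct (archimed (/ (q - p))) as [Ha _].
  assert (Hinv : 0 < / (q - p)) by (apply Rinv_0_lt_compat; lra).
  set (d := up (/ (q - p))) in *.
  assert (Hd : (0 < d)%Z) by (apply lt_IZR; lra).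
  destruct (archimed (p * IZR d)) as [Hm1 Hm2]; set (m := up (p * IZR d)) in *.
  exists (mkrat (Z.to_nat m) (Z.to_nat (- m)) (pred (Z.to_nat d))).
  rewrite rat_mkrat, Nat.succ_pred by lia.
  assert (E : INR (Z.to_nat m) - INR (Z.to_nat (- m)) = IZR m).
  { rewrite !INR_IZR_INZ, <- minus_IZR; f_equal; lia. }
  rewrite E, INR_IZR_INZ, Z2Nat.id by lia.
  assert (Hd' : 0 < IZR d) by now apply IZR_lt.
  assert (H1 : 1 < IZR d * (q - p)).
  { apply (Rmult_lt_compat_r (q - p)) in Ha; [|lra]. rewrite Rinv_l in Ha; lra. }
  split; apply (Rmult_lt_reg_r (IZR d)); try exact Hd';
    unfold Rdiv; rewrite Rmult_assoc, Rinv_l by lra; lra.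
Qed.

Lemma interval_dense p q : p < q -> exists c, p < lo c /\ lo c < hi c /\ hi c < q.
Proof.
  intros Hpq; destruct (rat_dense p q Hpq) as [c1 H1].
  destruct (rat_dense (rat c1) q ltac:(lra)) as [c2 H2].
  exists (Cantor.to_nat (c1, c2)); unfold lo, hi; rewrite Cantor.cancel_of_to; cbn; lra.
Qed.

Definition inside (n c c' : nat) : Prop :=
  lo c < lo c' /\ lo c' < hi c' /\ hi c' < hi c /\ hi c' - lo c' < / 2 ^ n.

(** If no interval inside passes the test, any interval inside will do: a Cantor realiser has to
produce a real number at all inputs. *)
Definition next (T : nat -> nat -> Prop) (n c : nat) : nat :=
  least (fun c' => inside n c c' /\ (T n c' \/ forall c'', ~ (inside n c c'' /\ T n c''))).

Definition shrink (T : nat -> nat -> Prop) (n : nat) : nat :=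
  nat_rect (fun _ => nat) (Cantor.to_nat (0%nat, half_power 0)) (next T) n.

Lemma next_inside T n c : lo c < hi c -> inside n c (next T n c).
Proof.
  intros Hc; unfold next.
  set (P := fun c' => inside n c c' /\ (T n c' \/ forall c'', ~ (inside n c c'' /\ T n c''))).
  enough (exists c', P c') as [c' Hc'] by apply (least_correct P c' Hc').
  destruct (classic (exists c'', inside n c c'' /\ T n c'')) as [(c' & H1 & H2)|Hno].
  - exists c'; split; auto.
  - destruct (interval_dense (lo c) (Rmin (hi c) (lo c + / 2 ^ n))) as (c' & H1 & H2 & H3).
    + pose proof (half_pow_pos n); apply Rmin_glb_lt; lra.
    + exists c'; split; [|right; intros c'' Hc''; apply Hno; now exists c''].
      pose proof (Rmin_l (hi c) (lo c + / 2 ^ n)); pose proof (Rmin_r (hi c) (lo c + / 2 ^ n)).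
      unfold inside; lra.
Qed.

Lemma next_passes T n c c' : inside n c c' -> T n c' -> T n (next T n c).
Proof.
  intros Hc' HT; unfold next.
  set (P := fun c' => inside n c c' /\ (T n c' \/ forall c'', ~ (inside n c c'' /\ T n c''))).
  destruct (least_correct P c' ltac:(split; auto)) as [_ [H|H]]; [exact H|exfalso; exact (H c' (conj Hc' HT))].
Qed.

Lemma shrink_props T n :
  inside n (shrink T n) (shrink T (S n)) /\ 0 <= lo (shrink T n) < hi (shrink T n) /\ hi (shrink T n) <= 1.
Proof.
  induction n as [|n [(H1 & H2 & H3 & H4) [H5 H6]]].
  - assert (E : lo (shrink T 0) = 0 /\ hi (shrink T 0) = 1).
    { unfold lo, hi; cbn [shrink nat_rect]; rewrite Cantor.cancel_of_to; cbn [fst snd].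
      rewrite rat_0, rat_half_power; cbn; lra. }
    split; [apply (next_inside T 0 (shrink T 0))|]; lra.
  - split; [apply (next_inside T (S n) (shrink T (S n)))|]; lra.
Qed.

Lemma shrink_limit T : exists x,
  rep RealS (fun n => fst (Cantor.of_nat (shrink T (S n)))) x /\
  forall n, lo (shrink T n) < x < hi (shrink T n).
Proof.
  assert (Hin : forall n, inside n (shrink T n) (shrink T (S n))) by apply shrink_props.
  destruct (nested_intervals (fun n => lo (shrink T n)) (fun n => hi (shrink T n))) as [x Hx].
  { intros n; specialize (Hin n); unfold inside in Hin; lra. }
  exists x; split; [|exact Hx]. split.
  - intros n i; change (Rabs (lo (shrink T (S n)) - lo (shrink T (S (n + i)))) < / 2 ^ n).
    assert (lo (shrink T (S n)) <= lo (shrink T (S (n + i)))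
            /\ hi (shrink T (S (n + i))) <= hi (shrink T (S n))).
    { induction i as [|i IH]; [rewrite Nat.add_0_r; lra|].
      rewrite Nat.add_succ_r; specialize (Hin (S (n + i))); unfold inside in Hin; lra. }
    pose proof (Hin n) as Hn; pose proof (shrink_props T (S (n + i))) as [_ Hi].
    unfold inside in Hn; apply Rabs_def1; lra.
  - change (is_lim_seq (fun n => lo (shrink T (S n))) x).
    apply is_lim_seq_spec; intros eps. destruct (half_pow_small eps (cond_pos eps)) as [N HN].
    exists N; intros n Hn; pose proof (half_pow_le N n Hn).
    specialize (Hin n); unfold inside in Hin; specialize (Hx (S n)).
    apply Rabs_def1; lra.
Qed.

Definition admissible (a : R -> bool) (y : R -> nat) : Prop :=
  (forall x, a x = true -> I01 x) /\ injective_on a y.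

(** The test [T A Y n c] must be decidable in every context, because it occurs under the quantifier
and the search of [next].  As in Baire's theorem, the passing intervals make up dense open
sets, one for each n, and their intersection misses A. *)
Lemma realiser_of_tests o (T : interp ty2 -> interp ty2 -> nat -> nat -> Prop) :
  (forall l A Y n c, Argument o l ty2 A -> Argument o l ty2 Y -> Computable o l n -> Computable o l c ->
     Decidable o l (fun xi => T (A xi) (Y xi) (n xi) (c xi))) ->
  (forall A Y a y, rep (FunS RealS BoolS) A a -> rep (FunS RealS NatS) Y y -> admissible a y ->
     (forall n p q, 0 <= p -> p < q -> q <= 1 ->
        exists c, p < lo c /\ lo c < hi c /\ hi c < q /\ T A Y n c) /\
     (forall x, I01 x ->
        (forall n, exists c, 0 <= lo c /\ hi c <= 1 /\ lo c < x < hi c /\ T A Y n c) -> a x = false)) ->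
  exists C, cantor_realiser C /\ ComputableF o [] cantor_ty (fun _ => C).
Proof.
  intros Hdec HT.
  exists (fun A Y n => fst (Cantor.of_nat (shrink (T A Y) (S n)))); split.
  - intros A Y a y HA HY.
    destruct (shrink_limit (T A Y)) as (x & Hx & Hin); exists x; split; [exact Hx|].
    intros _ H01 Hinj; destruct (HT A Y a y HA HY (conj H01 Hinj)) as [Hdense Hlim].
    assert (I01 x).
    { specialize (Hin 0%nat); pose proof (shrink_props (T A Y) 0); unfold I01; lra. }
    split; [assumption|]. apply Hlim; [assumption|]; intros n.
    exists (shrink (T A Y) (S n)).
    destruct (shrink_props (T A Y) (S n)) as [_ HSn], (shrink_props (T A Y) n) as [_ Hn].
    split; [lra|split; [lra|split; [apply Hin|]]].
    destruct (Hdense n (lo (shrink (T A Y) n))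
      (Rmin (hi (shrink (T A Y) n)) (lo (shrink (T A Y) n) + / 2 ^ n))) as (c & H1 & H2 & H3 & H4).
    + lra.
    + pose proof (half_pow_pos n); apply Rmin_glb_lt; lra.
    + pose proof (Rmin_l (hi (shrink (T A Y) n)) (lo (shrink (T A Y) n) + / 2 ^ n)); lra.
    + apply (next_passes (T A Y) n (shrink (T A Y) n) c); [|exact H4].
      pose proof (Rmin_l (hi (shrink (T A Y) n)) (lo (shrink (T A Y) n) + / 2 ^ n)).
      pose proof (Rmin_r (hi (shrink (T A Y) n)) (lo (shrink (T A Y) n) + / 2 ^ n)).
      unfold inside; lra.
  - change (Computable o [ty2; ty2; Nat]
      (fun xi => fst (Cantor.of_nat (shrink (T (fst xi) (fst (snd xi))) (S (fst (snd (snd xi)))))))).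
    apply computable_fst.
    apply (computable_rec o [ty2; ty2; Nat] (fun xi => S (fst (snd (snd xi))))
      (fun _ => Cantor.to_nat (0%nat, half_power 0))
      (fun p => next (T (fst (snd (snd p))) (fst (snd (snd (snd p))))) (fst p) (fst (snd p)))).
    + comp.
    + apply computable_const.
    + unfold next, inside, lo, hi.
      apply (computable_least o [Nat; Nat; ty2; ty2; Nat] (fun p c' => _)).
      comp; apply Hdec.
      all: first [var | comp].
Qed.

Lemma spike_solution X pre post H D Y a y :
  solves_self_osc X pre post H -> rep (FunS RealS NatS) Y y ->
  (forall x r, rep RealS x r -> (D x <-> a r = true)) ->
  admissible a y -> pre (spike a y) ->
  exists v, rep X (H (spike_rep D Y)) v /\ post (spike a y) v.
Proof.
  intros HH HY HD [_ Hinj] Hpre.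
  destruct (HH _ _ (rep_spike D Y a y HY HD)) as (v & Hv & Hpost).
  exists v; split; [exact Hv|]. apply Hpost; [exact Hpre|].
  intros x Hx; symmetry; now apply spike_osc.
Qed.

Lemma nonzero_iff A a : rep (FunS RealS BoolS) A a ->
  forall x r, rep RealS x r -> (A x <> 0%nat <-> a r = true).
Proof.
  intros HA x r Hx; rewrite (HA x r Hx); destruct (a r); cbn; split; easy.
Qed.

(** For problems whose solution is itself a zero of [spike]. *)
Lemma yields_realiser_direct pre post :
  (forall a y, admissible a y -> pre (spike a y)) ->
  (forall a y v, admissible a y -> post (spike a y) v -> I01 v /\ spike a y v = 0) ->
  yields_realiser RealS pre post.
Proof.
  intros Hpre Hpost o H Hhead Hsolves.
  exists (fun A Y => H (spike_rep (fun x => A x <> 0%nat) Y)); split.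
  - intros A Y a y HA HY.
    destruct (Hsolves _ _ (rep_spike _ Y a y HY (nonzero_iff A a HA))) as (r & Hr & Hp).
    exists r; split; [exact Hr|]. intros _ H01 Hinj.
    assert (Hadm : admissible a y) by now split.
    rewrite <- (spike_zero a y); apply Hpost; [exact Hadm|].
    apply Hp; [now apply Hpre|]. intros x Hx; symmetry; now apply spike_osc.
  - set (l := [ty2; ty2; Nat]).
    apply (applicable_nat o l), (applicable_app o l Nat Nat
      (fun xi => H (spike_rep (fun x => fst xi x <> 0%nat) (fst (snd xi)))) (fun xi => fst (snd (snd xi)))).
    + apply Hhead, (computableF_spike_rep o l (fun xi x => fst xi x <> 0%nat) (fun xi => fst (snd xi)));
        [|unfold l; var].
      apply decidable_not, decidable_eq; [|apply computable_const].
      apply (computable_apply_var o (Arr Nat Nat :: Nat :: l) (fun p => fst (snd (snd p))) (fun p => fst p));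
        [unfold l; var|apply computableF_var1, argument_head].
    + change (Computable o l (fun xi => fst (snd (snd xi)))); unfold l; comp.
Qed.

(** The error terms are those of the m-th approximations, so this says that the represented reals
differ by at most 2^-n ([close_iff]). *)
Definition close (x x' : nat -> nat) (n : nat) : Prop :=
  forall m, Rabs (rat (x m) - rat (x' m)) <= / 2 ^ n + (/ 2 ^ m + / 2 ^ m).

Lemma rep_error x r m : rep RealS x r -> Rabs (rat (x m) - r) <= / 2 ^ m.
Proof.
  intros [Hx Hlim].
  apply (is_lim_seq_le (fun i => Rabs (rat (x m) - rat (x (i + m)%nat))) (fun _ => / 2 ^ m)
           (Rabs (rat (x m) - r)) (/ 2 ^ m)).
  - intros i; rewrite Nat.add_comm; apply Rlt_le, Hx.
  - apply (is_lim_seq_abs _ (rat (x m) - r)), is_lim_seq_minus'; [apply is_lim_seq_const|].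
    now apply (is_lim_seq_incr_n (fun i => rat (x i))).
  - apply is_lim_seq_const.
Qed.

Lemma close_iff x x' r r' n : rep RealS x r -> rep RealS x' r' ->
  (close x x' n <-> Rabs (r - r') <= / 2 ^ n).
Proof.
  intros Hx Hx'; split; intros H.
  - apply Rnot_lt_le; intros Hlt.
    destruct (half_pow_small ((Rabs (r - r') - / 2 ^ n) / 4)) as [m Hm]; [lra|].
    specialize (H m); pose proof (rep_error x r m Hx) as E; pose proof (rep_error x' r' m Hx') as E'.
    revert Hlt Hm H E E'; unfold Rabs; repeat destruct Rcase_abs; lra.
  - intros m; pose proof (rep_error x r m Hx) as E; pose proof (rep_error x' r' m Hx') as E'.
    revert H E E'; unfold Rabs; repeat destruct Rcase_abs; lra.
Qed.

Lemma decidable_close o l x x' n :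
  ComputableF o l (Arr Nat Nat) x -> ComputableF o l (Arr Nat Nat) x' -> Computable o l n ->
  Decidable o l (fun xi => close (x xi) (x' xi) (n xi)).
Proof.
  intros Hx Hx' Hn; unfold close. 
  assert (Computable o (Nat :: l) (fun p => x (snd p) (fst p))) by exact Hx.
  assert (Computable o (Nat :: l) (fun p => x' (snd p) (fst p))) by exact Hx'.
  comp.
Qed.

Definition constant_seq (c : nat) : nat -> nat := fun _ => c.

Lemma computableF_constant_seq o l c :
  Computable o l c -> ComputableF o l (Arr Nat Nat) (fun xi => constant_seq (c xi)).
Proof.
  intros Hc; unfold constant_seq; change (Computable o (Nat :: l) (fun p => c (snd p))); comp.
Qed.

Lemma rational_avoidable p q r : p < q ->
  exists p' q', p <= p' /\ p' < q' /\ q' <= q /\ ~ p' < r < q'.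
Proof.
  intros Hpq; destruct (Rle_dec r ((p + q) / 2)).
  - exists ((p + q) / 2), q; lra.
  - exists p, ((p + q) / 2); lra.
Qed.

Lemma equal_rational_iff x r c : rep RealS x r ->
  ((forall n, close x (constant_seq c) n) <-> r = rat c).
Proof.
  intros Hx; split; intros H.
  - apply NNPP; intros Hne.
    destruct (half_pow_small (Rabs (r - rat c))) as [n Hn]; [apply Rabs_pos_lt; lra|].
    specialize (H n); apply (close_iff _ _ r (rat c)) in H; [lra|exact Hx|apply rep_rat].
  - intros n; apply (close_iff _ _ r (rat c)); [exact Hx|apply rep_rat|].
    rewrite H, Rminus_diag, Rabs_R0; apply Rlt_le, half_pow_pos.
Qed.

(** The new variable has to be inserted behind the arguments of the functional. *)
Lemma computableF_weaken o l s t F G :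
  ComputableF o l t F -> (forall a xi, G (a, xi) = F xi) -> ComputableF o (s :: l) t G.
Proof.
  intros [e He] E; set (n := length (args t)).
  destruct (kleene_select (n + (1 + (length l + 2))) (seq 0 n ++ seq (n + 1) (length l + 2)) e)
    as [e' He'].
  - apply NoDup_app; try apply seq_NoDup; intros j; rewrite !in_seq; lia.
  - intros j; rewrite in_app_iff, !in_seq; lia.
  - exists e'; intros zeta.
    specialize (He (join _ _ (take _ _ zeta) (snd (drop _ _ zeta)))).
    rewrite take_join, drop_join, <- (E (fst (drop _ _ zeta))), <- surjective_pairing in He.
    set (Phi := objs (snd (drop _ _ zeta)) ++ [o; Obj ty2 E2]).
    assert (HPhi : length Phi = (length l + 2)%nat) by (unfold Phi; now rewrite length_app, objs_length).
    assert (Hz : objs zeta ++ [o; Obj ty2 E2]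
                 = objs (take _ _ zeta) ++ [Obj s (fst (drop _ _ zeta))] ++ Phi).
    { rewrite <- (join_take_drop _ _ zeta) at 1; rewrite objs_join, <- app_assoc; reflexivity. }
    rewrite Hz; apply He'.
    + rewrite !length_app, objs_length, HPhi; reflexivity.
    + rewrite map_app, map_nth_seq0 by now rewrite objs_length.
      pose proof (map_nth_seq (objs (take _ _ zeta) ++ [Obj s (fst (drop _ _ zeta))]) Phi []
        (n + 1) (length l + 2)) as EPhi.
      rewrite app_nil_r, <- app_assoc in EPhi. rewrite EPhi.
      * rewrite objs_join, <- app_assoc in He; exact He.
      * rewrite length_app, objs_length; reflexivity.
      * now symmetry.
Qed.

(** The solution at a computable function.  Unlike [Applicable], this passes to longer contexts, and
the tests evaluate the solution under quantifiers. *)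
Definition SolutionValue o (X : rspace) l (V : env l -> interp (rty X)) : Prop :=
  exists H F, HeadApplicable o X H /\ ComputableF o l (rty RR) F /\ forall xi, V xi = H (F xi).

Lemma solution_weaken o X l s V W :
  SolutionValue o X l V -> (forall a xi, W (a, xi) = V xi) -> SolutionValue o X (s :: l) W.
Proof.
  intros (H & F & HH & HF & E) EW; exists H, (fun p => F (snd p)); split; [exact HH|split].
  - eapply computableF_weaken; [exact HF|reflexivity].
  - intros [a xi]; now rewrite EW.
Qed.

Lemma solution_applicable o X l V : SolutionValue o X l V -> Applicable o l (rty X) V.
Proof.
  intros (H & F & HH & HF & E) G HG.
  eapply computable_ext; [|exact (HH l F HF G HG)]. intros xi; now rewrite E.
Qed.

Ltac solved := first [assumption |
  eapply solution_weaken; cycle 1; [intros ? ?; cbn [fst snd]; reflexivity|solved]].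

(** The test [T V n c] may assume that no rational is in the set: the set A is replaced by its
irrational points, a decidable condition on representations, and the intervals are kept away
from the rationals one after the other. *)
Lemma yields_realiser_by_tests X pre post (T : interp (rty X) -> nat -> nat -> Prop) :
  (forall a y, admissible a y -> pre (spike a y)) ->
  (forall o l V n c, SolutionValue o X l V -> Computable o l n -> Computable o l c ->
     Decidable o l (fun xi => T (V xi) (n xi) (c xi))) ->
  (forall a y V v, admissible a y -> (forall c, a (rat c) = false) ->
     rep X V v -> post (spike a y) v ->
     (forall n p q, 0 <= p -> p < q -> q <= 1 ->
        exists c, p < lo c /\ lo c < hi c /\ hi c < q /\ T V n c) /\
     (forall x, I01 x ->
        (forall n, exists c, 0 <= lo c /\ hi c <= 1 /\ lo c < x < hi c /\ T V n c) ->
        a x = false)) ->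
  yields_realiser X pre post.
Proof.
  intros Hpre Hdec Htest o H Hhead Hsolves.
  set (D := fun (A : interp ty2) x =>
    A x <> 0%nat /\ forall c, ~ forall n, close x (constant_seq c) n).
  apply (realiser_of_tests o (fun A Y n c =>
    T (H (spike_rep (D A) Y)) n c /\ ~ (lo c < rat n /\ rat n < hi c))).
  - intros l A Y n c HA HY Hn Hc; apply decidable_and.
    + apply (Hdec o l (fun xi => H (spike_rep (D (A xi)) (Y xi)))); try assumption.
      eexists H, _; split; [exact Hhead|split; [|reflexivity]].
      apply (computableF_spike_rep o l (fun xi => D (A xi))); [|exact HY]; unfold D; apply decidable_and.
      * apply decidable_not, decidable_eq; [|apply computable_const].
        apply (computable_apply_var o (Arr Nat Nat :: Nat :: l) (fun p => A (snd (snd p))) (fun p => fst p));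
          [var|apply computableF_var1, argument_head].
      * apply (decidable_all o (Arr Nat Nat :: Nat :: l)
                 (fun p c => ~ forall n, close (fst p) (constant_seq c) n)).
        apply decidable_not.
        apply (decidable_all o (Nat :: Arr Nat Nat :: Nat :: l)
                 (fun p n => close (fst (snd p)) (constant_seq (fst p)) n)).
        apply (decidable_close o (Nat :: Nat :: Arr Nat Nat :: Nat :: l) (fun p => fst (snd (snd p)))
                 (fun p => constant_seq (fst (snd p)))).
        -- apply computableF_var1; var.
        -- apply computableF_constant_seq; comp.
        -- comp.
    + unfold lo, hi; comp.
  - intros A Y a y HA HY [H01 Hinj].
    set (a' := fun r => if excluded_middle_informative (exists c, r = rat c) then false else a r).
    assert (Ha' : forall r, a' r = true <-> a r = true /\ forall c, r <> rat c).
    { intros r; unfold a'; destruct excluded_middle_informative as [[c Hc]|Hno].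
      - split; [discriminate|intros [_ Hne]; now apply Hne in Hc].
      - split; [|tauto]; intros Har; split; [exact Har|intros c Hc; apply Hno; now exists c]. }
    assert (Hadm : admissible a' y).
    { split; [intros r Hr; now apply H01, Ha'|]. intros r r' Hr Hr'; apply Hinj; now apply Ha'. }
    destruct (spike_solution X pre post H (D A) Y a' y Hsolves HY) as (v & Hv & Hpost).
    { intros x r Hx; rewrite Ha', <- (nonzero_iff A a HA x r Hx); unfold D.
      split; intros [HA0 Hirr]; (split; [exact HA0|]); intros c Hc; apply (Hirr c);
        now apply (equal_rational_iff x r c Hx). }
    { exact Hadm. }
    { now apply Hpre. }
    destruct (Htest a' y (H (spike_rep (D A) Y)) v Hadm) with (2 := Hv) as [Hdense Hlim].
    { intros c; destruct (a' (rat c)) eqn:E; [|reflexivity].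
      apply Ha' in E as [_ E]; now specialize (E c). }
    { exact Hpost. }
    split.
    + intros n p q Hp Hpq Hq.
      destruct (rational_avoidable p q (rat n) Hpq) as (p' & q' & H1 & H2 & H3 & Hav).
      destruct (Hdense n p' q') as (c & Hc1 & Hc2 & Hc3 & Hc4); try lra.
      exists c; split; [lra|split; [exact Hc2|split; [lra|split; [exact Hc4|]]]].
      intros [Hc5 Hc6]; apply Hav; lra.
    + intros x Hx Hc.
      destruct (a x) eqn:Eax; [|reflexivity].
      assert (E : a' x = false).
      { apply Hlim; [exact Hx|]; intros n; destruct (Hc n) as (c & H1 & H2 & H3 & H4 & _).
        exists c; tauto. }
      assert (a' x = true); [|congruence].
      apply Ha'; split; [exact Eax|]. intros n ->.
      destruct (Hc n) as (c & _ & _ & H3 & _ & H4); tauto.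
Qed.

Lemma spike_null a y x : (forall n, spike a y x <= 2 * / 2 ^ n) -> a x = false.
Proof.
  intros H; unfold spike in H; destruct (a x); [exfalso|reflexivity].
  specialize (H (S (S (S (y x))))); rewrite (half_pow_S (S (S (y x)))), (half_pow_S (S (y x))) in H.
  pose proof (half_pow_pos (S (y x))); lra.
Qed.

Lemma continuity_point : hard RealS cliquish01 (fun f x => cont_pts f x).
Proof.
  apply hard_of_yields_realiser, yields_realiser_direct.
  - intros a y [_ Hinj]; now apply spike_cliquish01.
  - intros a y v [_ Hinj] Hv; apply spike_cont_pts in Hv as [Hv Ha]; [|exact Hinj].
    split; [exact Hv|now apply spike_zero].
Qed.

Lemma zero_of_null_function :
  hard RealS (fun f => cliquish01 f /\ is_RInt f 0 1 0) (fun f x => I01 x /\ f x = 0).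
Proof.
  apply hard_of_yields_realiser, yields_realiser_direct.
  - intros a y [_ Hinj]; split; [now apply spike_cliquish01|apply spike_is_RInt; [exact Hinj|lra]].
  - intros a y v _ Hv; exact Hv.
Qed.

(** The integral function is constantly 0, so its derivative exists everywhere and is 0. *)
Lemma lebesgue_point :
  hard RealS (fun f => cliquish01 f /\ ex_RInt f 0 1)
    (fun f x => I01 x /\ D_in (fun u => RInt f 0 u) f I01 x).
Proof.
  apply hard_of_yields_realiser, yields_realiser_direct.
  - intros a y [_ Hinj]; split; [now apply spike_cliquish01|].
    exists 0; apply spike_is_RInt; [exact Hinj|lra].
  - intros a y x [_ Hinj] [Hx HD]; split; [exact Hx|].
    assert (HI : forall u, I01 u -> RInt (spike a y) 0 u = 0).
    { intros u [Hu _]; apply is_RInt_unique, spike_is_RInt; assumption. }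
    destruct (spike_bounds a y x) as [[Hpos|Hz] _]; [exfalso|now symmetry].
    destruct (HD (spike a y x) Hpos) as (delta & Hd & Hlim).
    destruct (I01_subinterval x delta Hx Hd) as (p & q & Hp & Hpq & Hq & Hz).
    destruct (Hz p ltac:(lra)) as [Hpx Hpd].
    assert (Ip : I01 p) by (unfold I01; lra).
    specialize (Hlim p (conj (conj Ip (not_eq_sym Hpx)) Hpd)).
    change (Rabs ((RInt (spike a y) 0 p - RInt (spike a y) 0 x) / (p - x) - spike a y x)
            < spike a y x) in Hlim.
    rewrite !HI in Hlim by assumption.
    rewrite Rminus_diag in Hlim; unfold Rdiv in Hlim; rewrite Rmult_0_l in Hlim.
    apply Rabs_def2 in Hlim; lra.
Qed.

Lemma applicable_on_rational o l t V c :
  Applicable o l (Arr (Arr Nat Nat) t) V -> Computable o l c ->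
  Applicable o l t (fun xi => V xi (constant_seq (c xi))).
Proof.
  intros HV Hc; apply (applicable_app o l (Arr Nat Nat) t V);
    [exact HV|now apply computableF_constant_seq].
Qed.

Lemma computableF_of_applicable o l x : Applicable o (Nat :: l) (Arr Nat Nat) (fun p => x (snd p)) ->
  ComputableF o l (Arr Nat Nat) x.
Proof.
  intros Hx; apply (applicable_nat o (Nat :: l)), 
    (applicable_app o (Nat :: l) Nat Nat (fun p => x (snd p)) (fun p => fst p));
    [exact Hx|apply computable_var0].
Qed.

Lemma applicable_on_number o l t V c :
  Applicable o l (Arr Nat t) V -> Computable o l c -> Applicable o l t (fun xi => V xi (c xi)).
Proof. intros HV Hc; exact (applicable_app o l Nat t V c HV Hc). Qed.

Lemma admissible_cliquish01 a y : admissible a y -> cliquish01 (spike a y).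
Proof. intros [_ Hinj]; now apply spike_cliquish01. Qed.

Lemma spike_rational a y c : a (rat c) = false -> spike a y (rat c) = 0.
Proof. apply spike_zero. Qed.

(** The test says that the supremum over the interval is at most 2^-n. *)
Lemma supremum : hard (FunS RealS RR) cliquish01
    (fun f s => forall p q, 0 <= p -> p <= q -> q <= 1 ->
       is_lub (image f (fun x => p <= x <= q)) (s p q)).
Proof.
  apply hard_of_yields_realiser.
  apply (yields_realiser_by_tests (FunS RealS RR) _ _ (fun V n c =>
    close (V (constant_seq (fst (Cantor.of_nat c))) (constant_seq (snd (Cantor.of_nat c)))) (constant_seq 0) n)).
  - exact admissible_cliquish01.
  - intros o l V n c HV Hn Hc.
    apply (decidable_close o l (fun xi => V xi (constant_seq (fst (Cantor.of_nat (c xi))))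
      (constant_seq (snd (Cantor.of_nat (c xi)))))).
    + apply computableF_of_applicable.
      apply (applicable_on_rational o (Nat :: l) (Arr Nat Nat)
               (fun p => V (snd p) (constant_seq (fst (Cantor.of_nat (c (snd p))))))); [|comp].
      apply (applicable_on_rational o (Nat :: l) _ (fun p => V (snd p))); [|comp].
      apply (solution_applicable o (FunS RealS RR)); solved.
    + apply computableF_constant_seq; comp.
    + exact Hn.
  - intros a y V v [_ Hinj] Hrat HV Hlub.
    assert (HT : forall n c,
      close (V (constant_seq (fst (Cantor.of_nat c))) (constant_seq (snd (Cantor.of_nat c)))) (constant_seq 0) n
      <-> Rabs (v (lo c) (hi c) - rat 0) <= / 2 ^ n).
    { intros n c; apply close_iff; [apply HV; apply rep_rat|apply rep_rat]. }
    rewrite rat_0 in HT; setoid_rewrite HT; clear HT. split.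
    + intros n p q Hp Hpq Hq.
      destruct (spike_subinterval a y p q (/ 2 ^ n) Hinj Hpq (half_pow_pos n)) as (p' & q' & H1 & H2 & H3 & Hs).
      destruct (interval_dense p' q' H2) as (c & Hc1 & Hc2 & Hc3).
      exists c; split; [lra|split; [exact Hc2|split; [lra|]]].
      destruct (Hlub (lo c) (hi c)) as [Hub Hl]; try lra.
      assert (v (lo c) (hi c) <= / 2 ^ n).
      { apply Hl; intros r (z & Hz & ->); apply Rlt_le, Hs; lra. }
      assert (spike a y (lo c) <= v (lo c) (hi c)) by (apply Hub; exists (lo c); split; [lra|reflexivity]).
      pose proof (spike_bounds a y (lo c)). rewrite Rminus_0_r, Rabs_pos_eq; lra.
    + intros x Hx H; apply (spike_null a y); intros n.
      destruct (H n) as (c & H1 & H2 & H3 & H4).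
      destruct (Hlub (lo c) (hi c)) as [Hub _]; try lra.
      assert (spike a y x <= v (lo c) (hi c)) by (apply Hub; exists x; split; [lra|reflexivity]).
      rewrite Rminus_0_r in H4; apply Rabs_le_between in H4.
      pose proof (half_pow_pos n); lra.
Qed.

(** The test says that the interval is part of one of the intervals of the n-th open set, which is
dense because the rationals are continuity points. *)
Lemma continuity_set : hard (FunS NatS (FunS NatS Rat2S)) cliquish01
    (fun f z => forall x, cont_pts f x <->
       forall n, exists m, fst (z m n) < x < snd (z m n)).
Proof.
  apply hard_of_yields_realiser.
  apply (yields_realiser_by_tests (FunS NatS (FunS NatS Rat2S)) _ _ (fun V n c =>
    exists m, lo (V m n) <= lo c /\ hi c <= hi (V m n))).
  - exact admissible_cliquish01.
  - intros o l V n c HV Hn Hc.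
    apply (decidable_ex o l (fun xi m => lo (V xi m (n xi)) <= lo (c xi) /\ hi (c xi) <= hi (V xi m (n xi)))).
    assert (HVm : Computable o (Nat :: l) (fun p => V (snd p) (fst p) (n (snd p)))).
    { apply applicable_nat, (applicable_on_number o (Nat :: l) Nat (fun p => V (snd p) (fst p))); [|comp].
      apply (applicable_on_number o (Nat :: l) _ (fun p => V (snd p))); [|comp].
      apply (solution_applicable o (FunS NatS (FunS NatS Rat2S))); solved. }
    unfold lo, hi; comp.
  - intros a y V v [_ Hinj] Hrat HV Hv.
    assert (E : forall m n, v m n = (lo (V m n), hi (V m n))).
    { intros m n; exact (HV m m eq_refl n n eq_refl). }
    setoid_rewrite (fun x => spike_cont_pts a y x Hinj) in Hv. split.
    + intros n p q Hp Hpq Hq.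
      destruct (rat_dense p q Hpq) as [c Hc].
      assert (Ic : I01 (rat c)) by (unfold I01; lra).
      destruct (proj1 (Hv (rat c)) (conj Ic (Hrat c)) n) as [m Hm].
      rewrite E in Hm; cbn [fst snd] in Hm.
      destruct (interval_dense (Rmax p (lo (V m n))) (Rmin q (hi (V m n)))) as (c' & H1 & H2 & H3).
      { apply Rmax_lub_lt; apply Rmin_glb_lt; lra. }
      pose proof (Rmax_l p (lo (V m n))); pose proof (Rmax_r p (lo (V m n))).
      pose proof (Rmin_l q (hi (V m n))); pose proof (Rmin_r q (hi (V m n))).
      exists c'; repeat split; try lra. exists m; lra.
    + intros x Hx H; apply (Hv x); intros n.
      destruct (H n) as (c & _ & _ & H3 & m & H4). exists m; rewrite E; cbn [fst snd]; lra.
Qed.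

Lemma qc_rational g p q x eps : quasi_continuous g -> 0 <= p -> q <= 1 -> p < x < q -> 0 < eps ->
  exists c, p < rat c < q /\ Rabs (g x - g (rat c)) < eps.
Proof.
  intros Hg Hp Hq Hx He.
  destruct (Hg x eps (fun z => p < z < q)) as (G & HG & [z Hz] & HU & Hgx);
    [unfold I01; lra|exact He|now apply open_in_I_interval|exact Hx|].
  destruct (open_in_I_ball G z HG Hz) as (delta & Hd & Hball).
  specialize (HU z Hz).
  destruct (rat_dense (Rmax p (z - delta)) (Rmin q (z + delta))) as [c Hc].
  { apply Rmax_lub_lt; apply Rmin_glb_lt; lra. }
  pose proof (Rmax_l p (z - delta)); pose proof (Rmax_r p (z - delta)).
  pose proof (Rmin_l q (z + delta)); pose proof (Rmin_r q (z + delta)).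
  exists c; split; [lra|]. apply Hgx, Hball; [unfold I01; lra|apply Rabs_def1; lra].
Qed.

Lemma qc_interval g p q eps : quasi_continuous g -> 0 <= p -> p < q -> q <= 1 -> 0 < eps ->
  exists p' q', p <= p' /\ p' < q' /\ q' <= q /\
    forall x z, p' < x < q' -> p' < z < q' -> Rabs (g x - g z) <= eps.
Proof.
  intros Hg Hp Hpq Hq He. set (x0 := (p + q) / 2).
  destruct (Hg x0 (eps / 2) (fun z => p < z < q)) as (G & HG & [z Hz] & HU & Hgx);
    [unfold I01, x0; lra|lra|now apply open_in_I_interval|unfold x0; lra|].
  destruct (open_in_I_ball G z HG Hz) as (delta & Hd & Hball).
  specialize (HU z Hz).
  pose proof (Rmax_l p (z - delta)); pose proof (Rmax_r p (z - delta)).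
  pose proof (Rmin_l q (z + delta)); pose proof (Rmin_r q (z + delta)).
  exists (Rmax p (z - delta)), (Rmin q (z + delta)); repeat split; try lra.
  - apply Rmax_lub_lt; apply Rmin_glb_lt; lra.
  - assert (Hx0 : forall u, Rmax p (z - delta) < u < Rmin q (z + delta) -> Rabs (g x0 - g u) < eps / 2).
    { intros u Hu; apply Hgx, Hball; [unfold I01; lra|apply Rabs_def1; lra]. }
    intros u w Hu Hw; pose proof (Rabs_def2 _ _ (Hx0 u Hu)); pose proof (Rabs_def2 _ _ (Hx0 w Hw)).
    apply Rlt_le, Rabs_def1; lra.
Qed.

(** A quasi-continuous function is determined up to arbitrarily small errors by its values at
rationals, so that E2 can bound its variation on an interval. *)
Lemma qc_from_rationals g p q b : quasi_continuous g -> 0 <= p -> q <= 1 ->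
  (forall c c', p < rat c < q -> p < rat c' < q -> Rabs (g (rat c) - g (rat c')) <= b) ->
  forall x z, p < x < q -> p < z < q -> Rabs (g x - g z) <= b.
Proof.
  intros Hg Hp Hq H x z Hx Hz; apply le_epsilon; intros eps He.
  destruct (qc_rational g p q x (eps / 2) Hg Hp Hq Hx ltac:(lra)) as (c & Hc & Hxc).
  destruct (qc_rational g p q z (eps / 2) Hg Hp Hq Hz ltac:(lra)) as (c' & Hc' & Hzc).
  specialize (H c c' Hc Hc'). apply Rabs_def2 in Hxc, Hzc; apply Rabs_le_between in H.
  apply Rabs_le_between; lra.
Qed.

(** The test says that both summands vary by at most 2^-n among the rationals of the interval, hence
on the whole interval; their sum then varies by at most twice that, and it is 0 at the rationals. *)
Lemma decomposition : hard (PairS RR) cliquish01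
    (fun f gh =>
       (forall x, I01 x -> f x = fst gh x + snd gh x) /\
       quasi_continuous (fst gh) /\ quasi_continuous (snd gh)).
Proof.
  apply hard_of_yields_realiser.
  apply (yields_realiser_by_tests (PairS RR) _ _ (fun V n c =>
    forall r s, lo c < rat r /\ rat r < hi c /\ lo c < rat s /\ rat s < hi c ->
      close (V 0%nat (constant_seq r)) (V 0%nat (constant_seq s)) n /\
      close (V 1%nat (constant_seq r)) (V 1%nat (constant_seq s)) n)).
  - exact admissible_cliquish01.
  - intros o l V n c HV Hn Hc.
    assert (HVr : forall i l' W r, SolutionValue o (PairS RR) l' W -> Computable o l' r ->
      ComputableF o l' (Arr Nat Nat) (fun p => W p i (constant_seq (r p)))).
    { intros i l' W r HW Hr; apply computableF_of_applicable.
      apply (applicable_on_rational o (Nat :: l') (Arr Nat Nat) (fun p => W (snd p) i)); [|comp].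
      apply (applicable_on_number o (Nat :: l') (rty RR) (fun p => W (snd p)) (fun _ => i));
        [|apply computable_const].
      apply (solution_applicable o (PairS RR)); solved. }
    unfold lo, hi; comp.
    + apply (decidable_close o (Nat :: Nat :: l) (fun p => V (snd (snd p)) 0%nat (constant_seq (fst (snd p))))
        (fun p => V (snd (snd p)) 0%nat (constant_seq (fst p))) (fun p => n (snd (snd p)))).
      * apply (HVr 0%nat (Nat :: Nat :: l) (fun p => V (snd (snd p))) (fun p => fst (snd p))); [solved|comp].
      * apply (HVr 0%nat (Nat :: Nat :: l) (fun p => V (snd (snd p))) (fun p => fst p)); [solved|comp].
      * comp.
    + apply (decidable_close o (Nat :: Nat :: l) (fun p => V (snd (snd p)) 1%nat (constant_seq (fst (snd p))))
        (fun p => V (snd (snd p)) 1%nat (constant_seq (fst p))) (fun p => n (snd (snd p)))).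
      * apply (HVr 1%nat (Nat :: Nat :: l) (fun p => V (snd (snd p))) (fun p => fst (snd p))); [solved|comp].
      * apply (HVr 1%nat (Nat :: Nat :: l) (fun p => V (snd (snd p))) (fun p => fst p)); [solved|comp].
      * comp.
  - intros a y V [g h] _ Hrat [HV0 HV1] (Hsum & Hg & Hh); cbn [fst snd] in *.
    assert (H0 : forall r s n, close (V 0%nat (constant_seq r)) (V 0%nat (constant_seq s)) n
                   <-> Rabs (g (rat r) - g (rat s)) <= / 2 ^ n)
      by (intros; apply close_iff; apply HV0, rep_rat).
    assert (H1 : forall r s n, close (V 1%nat (constant_seq r)) (V 1%nat (constant_seq s)) n
                   <-> Rabs (h (rat r) - h (rat s)) <= / 2 ^ n)
      by (intros; apply close_iff; apply HV1, rep_rat).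
    split.
    + intros n p q Hp Hpq Hq.
      destruct (qc_interval g p q (/ 2 ^ n) Hg Hp Hpq Hq (half_pow_pos n)) as (p1 & q1 & Hp1 & Hpq1 & Hq1 & Hg1).
      destruct (qc_interval h p1 q1 (/ 2 ^ n) Hh) as (p2 & q2 & Hp2 & Hpq2 & Hq2 & Hh2);
        try lra; [apply half_pow_pos|].
      destruct (interval_dense p2 q2 Hpq2) as (c & Hc1 & Hc2 & Hc3).
      exists c; split; [lra|split; [exact Hc2|split; [lra|]]].
      intros r s Hrs; rewrite H0, H1; split; [apply Hg1|apply Hh2]; lra.
    + intros x Hx H; apply (spike_null a y); intros n.
      destruct (H n) as (c & Hc1 & Hc2 & Hc3 & HT).
      destruct (rat_dense (lo c) (hi c)) as [r Hr]; [lra|].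
      assert (Eg : Rabs (g x - g (rat r)) <= / 2 ^ n).
      { apply (qc_from_rationals g (lo c) (hi c)); try assumption.
        intros s t Hs Ht; apply H0, HT; lra. }
      assert (Eh : Rabs (h x - h (rat r)) <= / 2 ^ n).
      { apply (qc_from_rationals h (lo c) (hi c)); try assumption.
        intros s t Hs Ht; apply H1, HT; lra. }
      pose proof (Hsum (rat r) ltac:(unfold I01; lra)) as Er.
      rewrite spike_rational in Er by apply Hrat. rewrite Hsum by exact Hx.
      apply Rabs_le_between in Eg, Eh; lra.
Qed.

(** The test says that the interval is part of the neighbourhood that the modulus gives for some
rational and n.  At points of A the modulus carries no information. *)
Lemma continuity_modulus : hard (FunS RealS (FunS NatS NatS)) cliquish01
    (fun f M => modulus_of_continuity f M).
Proof.
  apply hard_of_yields_realiser.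
  apply (yields_realiser_by_tests (FunS RealS (FunS NatS NatS)) _ _ (fun V n c =>
    exists r, (0 <= rat r /\ rat r <= 1) /\
      rat r - / 2 ^ V (constant_seq r) n <= lo c /\ hi c <= rat r + / 2 ^ V (constant_seq r) n)).
  - exact admissible_cliquish01.
  - intros o l V n c HV Hn Hc.
    assert (HVr : Computable o (Nat :: l) (fun p => V (snd p) (constant_seq (fst p)) (n (snd p)))).
    { apply applicable_nat, (applicable_on_number o (Nat :: l) Nat
        (fun p => V (snd p) (constant_seq (fst p)))); [|comp].
      apply (applicable_on_rational o (Nat :: l) _ (fun p => V (snd p))); [|comp].
      apply (solution_applicable o (FunS RealS (FunS NatS NatS))); solved. }
    unfold lo, hi; comp.
  - intros a y V M [_ Hinj] Hrat HV HM.
    assert (E : forall r n, V (constant_seq r) n = M (rat r) n)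
      by (intros r n; exact (HV _ _ (rep_rat r) n n eq_refl)).
    split.
    + intros n p q Hp Hpq Hq.
      destruct (rat_dense p q Hpq) as [r Hr].
      set (e := / 2 ^ V (constant_seq r) n).
      assert (He : 0 < e) by apply half_pow_pos.
      destruct (interval_dense (Rmax p (rat r - e)) (Rmin q (rat r + e))) as (c & H1 & H2 & H3).
      { apply Rmax_lub_lt; apply Rmin_glb_lt; lra. }
      pose proof (Rmax_l p (rat r - e)); pose proof (Rmax_r p (rat r - e)).
      pose proof (Rmin_l q (rat r + e)); pose proof (Rmin_r q (rat r + e)).
      exists c; repeat split; try lra. exists r; fold e; lra.
    + intros x Hx H; apply (spike_null a y); intros n.
      destruct (H n) as (c & Hc1 & Hc2 & Hc3 & r & Hr & Hr1 & Hr2).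
      assert (Hcont : cont_pts (spike a y) (rat r)).
      { apply spike_cont_pts; [exact Hinj|]. split; [exact Hr|apply Hrat]. }
      rewrite E in Hr1, Hr2.
      specialize (HM n (rat r) x Hcont Hx ltac:(apply Rabs_def1; lra)).
      rewrite spike_rational in HM by apply Hrat.
      apply Rabs_def2 in HM; pose proof (half_pow_pos n); lra.
Qed.

(** The test says that the interval is part of a value of the modulus at n.  On such an interval
[spike] is below 2^-n, because it is 0 at the rationals. *)
Lemma cliquishness_modulus : hard (FunS RealS (FunS NatS (FunS NatS Rat2S))) cliquish01
    (fun f M => modulus_of_cliquishness f M).
Proof.
  apply hard_of_yields_realiser.
  apply (yields_realiser_by_tests (FunS RealS (FunS NatS (FunS NatS Rat2S))) _ _ (fun V n c =>
    exists r N, (0 <= rat r /\ rat r <= 1) /\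
      lo (V (constant_seq r) n N) <= lo c /\ hi c <= hi (V (constant_seq r) n N))).
  - exact admissible_cliquish01.
  - intros o l V n c HV Hn Hc.
    assert (HVr : Computable o (Nat :: Nat :: l)
              (fun p => V (snd (snd p)) (constant_seq (fst (snd p))) (n (snd (snd p))) (fst p))).
    { apply applicable_nat, (applicable_on_number o (Nat :: Nat :: l) Nat
        (fun p => V (snd (snd p)) (constant_seq (fst (snd p))) (n (snd (snd p))))); [|comp].
      apply (applicable_on_number o (Nat :: Nat :: l) (Arr Nat Nat)
        (fun p => V (snd (snd p)) (constant_seq (fst (snd p))))); [|comp].
      apply (applicable_on_rational o (Nat :: Nat :: l) (Arr Nat (Arr Nat Nat))
        (fun p => V (snd (snd p)))); [|comp].
      apply (solution_applicable o (FunS RealS (FunS NatS (FunS NatS Rat2S)))); solved. }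
    unfold lo, hi; comp.
  - intros a y V M _ Hrat HV HM.
    assert (E : forall r n N, M (rat r) n N = (lo (V (constant_seq r) n N), hi (V (constant_seq r) n N)))
      by (intros r n N; exact (HV _ _ (rep_rat r) n n eq_refl N N eq_refl)).
    split.
    + intros n p q Hp Hpq Hq.
      destruct (rat_dense p q Hpq) as [r Hr].
      destruct (half_pow_small (Rmin (rat r - p) (q - rat r))) as [N HN]; [apply Rmin_glb_lt; lra|].
      pose proof (Rmin_l (rat r - p) (q - rat r)); pose proof (Rmin_r (rat r - p) (q - rat r)).
      specialize (HM (rat r) n N ltac:(unfold I01; lra)); rewrite E in HM.
      destruct HM as (Hlt & Hsub & _).
      destruct (interval_dense _ _ Hlt) as (c & H1 & H2 & H3).
      destruct (Hsub (lo c) ltac:(lra)) as [Hlo _]; destruct (Hsub (hi c) ltac:(lra)) as [Hhi _].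
      apply Rabs_def2 in Hlo, Hhi.
      exists c; repeat split; try lra. exists r, N; lra.
    + intros x Hx H; apply (spike_null a y); intros n.
      destruct (H n) as (c & Hc1 & Hc2 & Hc3 & r & N & Hr & Hr1 & Hr2).
      specialize (HM (rat r) n N Hr); rewrite E in HM; destruct HM as (_ & _ & Hosc).
      destruct (rat_dense (lo c) (hi c)) as [s Hs]; [lra|].
      specialize (Hosc x (rat s) ltac:(lra) ltac:(lra)).
      rewrite spike_rational in Hosc by apply Hrat.
      apply Rabs_def2 in Hosc; pose proof (half_pow_pos n); lra.
Qed.

Theorem theorem2p5 :
  (* (a) *)
  hard RealS cliquish01 (fun f x => cont_pts f x) /\
  (* (b) *)
  hard (FunS RealS RR) cliquish01
    (fun f s => forall p q, 0 <= p -> p <= q -> q <= 1 ->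
       is_lub (image f (fun x => p <= x <= q)) (s p q)) /\
  (* (c) *)
  hard (FunS NatS (FunS NatS Rat2S)) cliquish01
    (fun f z => forall x, cont_pts f x <->
       forall n, exists m, fst (z m n) < x < snd (z m n)) /\
  (* (d) *)
  hard (PairS RR) cliquish01
    (fun f gh =>
       (forall x, I01 x -> f x = fst gh x + snd gh x) /\
       quasi_continuous (fst gh) /\ quasi_continuous (snd gh)) /\
  (* (e) *)
  hard (FunS RealS (FunS NatS NatS)) cliquish01
    (fun f M => modulus_of_continuity f M) /\
  (* (f) *)
  hard (FunS RealS (FunS NatS (FunS NatS Rat2S))) cliquish01
    (fun f M => modulus_of_cliquishness f M) /\
  (* (g) *)
  hard RealS (fun f => cliquish01 f /\ is_RInt f 0 1 0)
    (fun f x => I01 x /\ f x = 0) /\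
  (* (h) *)
  hard RealS (fun f => cliquish01 f /\ ex_RInt f 0 1)
    (fun f x => I01 x /\ D_in (fun u => RInt f 0 u) f I01 x).
Proof.
  exact (conj continuity_point (conj supremum (conj continuity_set (conj decomposition
    (conj continuity_modulus (conj cliquishness_modulus
      (conj zero_of_null_function lebesgue_point))))))).
Qed.
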